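(* Let $A,B,C,P,Q\in\mathbb{C}^{N\times N}$ be pairwise commuting positive stable matrices. Then, for $|z|<1$ and real $t<x$, $$\int_t^x (x-s)^{P-I}(s-t)^{Q-I}\,{}_1F_2(A;B,C;z(s-t))\,ds=\Gamma(P)\Gamma(Q)\Gamma^{-1}(P+Q)(x-t)^{P+Q-I}\,{}_2F_3(A,Q;B,P+Q,C;z(x-t)),$$ and for real $x<y$, $$\int_x^y (y-t)^{P-I}(t-x)^{Q-I}\,{}_1F_2(A;B,C;t-x)\,dt=\Gamma(P)\Gamma(Q)\Gamma^{-1}(P+Q)(y-x)^{P+Q-I}\,{}_2F_3(A,Q;P+Q,B,C;y-x)$$ and $$\int_x^y (y-t)^{P-I}(t-x)^{Q-I}\,{}_1F_2(A;B,C;x-t)\,dt=\Gamma(P)\Gamma(Q)\Gamma^{-1}(P+Q)(y-x)^{P+Q-I}\,{}_2F_3(A,Q;P+Q,B,C;x-y).$$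
   Context: $I$ is the $N\times N$ identity matrix. A matrix is positive stable if all its eigenvalues have positive real part. For $M\in\mathbb{C}^{N\times N}$, $(M)_0=I$, $(M)_k=M(M+I)\cdots(M+(k-1)I)$ for $k\ge1$; for $t>0$, $t^M=\exp(M\ln t)$. For $M$ positive stable $\Gamma(M)=\int_0^\infty e^{-t}t^{M-I}\,dt$, with inverse $\Gamma^{-1}(M)$. For commuting matrices, ${}_1F_2(A;B,C;z)=\sum_{k\ge0}\frac{z^k}{k!}(A)_k[(B)_k]^{-1}[(C)_k]^{-1}$ and ${}_2F_3(A,A';B,B',C;z)=\sum_{k\ge0}\frac{z^k}{k!}(A)_k(A')_k[(B)_k]^{-1}[(B')_k]^{-1}[(C)_k]^{-1}$. *)

(* Defs.v *)
From HB Require Import structures.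
From mathcomp Require Export all_boot all_order all_algebra.
From mathcomp Require Export all_classical all_reals all_analysis.
From mathcomp Require Export complex.

Set Implicit Arguments.
Unset Strict Implicit.
Unset Printing Implicit Defensive.

Export Order.TTheory GRing.Theory Num.Theory.
Export numFieldNormedType.Exports.

Local Open Scope classical_set_scope.
Local Open Scope ring_scope.
Local Open Scope complex_scope.

(* [R[i]] has no topology in the libraries; it gets the one of the modulus, so
   that ['M[R[i]]_N] gets its usual (sup-norm) topology. *)
HB.instance Definition _ (R : realType) := NormedModule.copy R[i] R[i]^o.

Section MatrixFunctions.
Context {R : realType} {N : nat}.
Local Notation C := R[i].
Implicit Types (A B M : 'M[C]_N) (f : R -> 'M[C]_N) (D : set R).

Definition positive_stable M : Prop :=
  forall a : C, eigenvalue M a -> 0 < complex.Re a.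

Definition mx_integrable D f : Prop :=
  forall i j,
    lebesgue_measure.-integrable D (fun s => (complex.Re (f s i j))%:E) /\
    lebesgue_measure.-integrable D (fun s => (complex.Im (f s i j))%:E).

Definition mx_integral D f : 'M[C]_N :=
  \matrix_(i, j)
    ((\int[lebesgue_measure]_(s in D) complex.Re (f s i j))
     +i* (\int[lebesgue_measure]_(s in D) complex.Im (f s i j))).

Definition mx_exp M : 'M[C]_N :=
  limn (series (fun k => (k`!%:R : C)^-1 *: M ^+ k)).

(* [t ^ M], meaningful for [0 < t] only. *)
Definition mx_rpow (t : R) M : 'M[C]_N := mx_exp ((ln t)%:C *: M).

Definition mx_poch M (k : nat) : 'M[C]_N := \prod_(j < k) (M + (j%:R)%:M).

Definition mx_Gamma M : 'M[C]_N :=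
  mx_integral `]0, +oo[ (fun t => (expR (- t))%:C *: mx_rpow t (M - 1%:M)).

Definition mx_1F2 A B B' (z : C) : 'M[C]_N :=
  limn (series (fun k => (z ^+ k / k`!%:R) *:
    (mx_poch A k *m invmx (mx_poch B k) *m invmx (mx_poch B' k)))).

Definition mx_2F3 A A' B B' B'' (z : C) : 'M[C]_N :=
  limn (series (fun k => (z ^+ k / k`!%:R) *:
    (mx_poch A k *m mx_poch A' k *m
     invmx (mx_poch B k) *m invmx (mx_poch B' k) *m invmx (mx_poch B'' k)))).

End MatrixFunctions.

(* The integral of [f] over [D] converges absolutely, with value [V]: the
   default value of [mx_integral] at a non-integrable [f] is excluded. *)
Definition has_mx_integral {R : realType} {N : nat} (D : set R)
    (f : R -> 'M[R[i]]_N) (V : 'M[R[i]]_N) : Prop :=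
  mx_integrable D f /\ mx_integral D f = V.

(* Main.v *)
From mathcomp Require Import measurable_realfun ring lra.
Require Import Defs.

(** Write [l = x - t] and [B(P, Q)] for the integral of
    [(1 - u) ^ (P - 1) u ^ (Q - 1)] over [0 < u < 1].  The substitution
    [s = t + l u] turns the integral of the [k]-th term of the series on the left
    into [l ^ k l ^ (P + Q - 1) B(P, Q + k)] times a constant matrix
    ([kernel_moment]).  One integration by parts gives
    [B(P, Q + 1) (P + Q) = B(P, Q) Q] ([Beta_recr]), hence
    [B(P, Q + k) = B(P, Q) (Q)_k (P + Q)_k ^ -1] ([Beta_pochr]): this is the factor
    that turns the coefficients of [1F2] into those of [2F3].  Termwise integration
    is dominated convergence ([mx_dct]), because the coefficients of [1F2] grow at
    most geometrically ([coef_1F2_le]), so that the partial sums are bounded on the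
    segment.  Convergence of the [2F3] series then comes for free: its partial sums
    are integrals that converge, multiplied by the inverse of a fixed matrix.  The
    last two formulas are the cases [z = 1] and [z = -1] of [mx_1F2_integral].

    It remains to see that [B(P, Q) = Gamma(P) Gamma(Q) Gamma(P + Q) ^ -1].  After
    the scaling [u = v / m], [m ^ Q B(P + 1 + m, Q)] is the integral of
    [(1 - v / m) ^ (P + m) v ^ (Q - 1)] over [0 < v < m], and tends to [Gamma(Q)] by
    dominated convergence ([Gamma_limit]).  The recurrences for [B] relate these
    approximations for the arguments [Q], [P] and [P + Q] exactly, for every [m],
    and the limit of the relation is [Gamma(Q) Gamma(P) = B(P, Q) Gamma(P + Q)]
    ([Gamma_Beta]); no double integral is involved.  The matrix [Gamma(X)] is
    invertible ([Gamma_unit]) because its approximations [m ^ X m! (X)_(m+1) ^ -1]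
    have bounded inverses: with [h = 1 / m], passing from [m - 1] to [m] multiplies
    the inverse by [(1 + h X) (1 - h) ^ X = 1 + O(h ^ 2)] ([ratio_factor_le],
    [Gamma_inv_approx_bounded]).

    Positive stability enters only through the estimate
    [|e ^ (- s X)| <= K e ^ (- a s)] with [0 < a], for [0 <= s]
    ([positive_stable_decay]), which Cayley-Hamilton gives by treating one eigenvalue
    at a time ([mexp_decay_annihilated]).  This estimate, named [decays], passes to
    sums of commuting matrices and forces invertibility ([decaysD], [decays_unit]);
    so the spectra of [P + Q], [B + k] or [C + k] never have to be located.

    A complex matrix is handled through its finitely many real coordinates
    [rcoord]: limits, derivatives and integrals are taken coordinatewise, and the
    matrix product is bilinear in the coordinates ([rcoordM]). *)

Set Implicit Arguments.
Unset Strict Implicit.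
Unset Printing Implicit Defensive.

Local Open Scope classical_set_scope.
Local Open Scope ring_scope.
Local Open Scope complex_scope.

(** * Real coordinates and a submultiplicative norm *)

Section Components.
Context {R : realType} {n : nat}.
Local Notation C := R[i].
Local Notation M := 'M[C]_n.+1.
Local Notation idx := ('I_n.+1 * 'I_n.+1 * bool)%type.
Implicit Types (c d e : idx) (X Y : M).

(** Real and imaginary parts are indexed together, so that one finite sum runs over
    all real coordinates and the real theory applies to each of them uniformly. *)
Definition rcoord c X : R :=
  if c.2 then complex.Im (X c.1.1 c.1.2) else complex.Re (X c.1.1 c.1.2).

Definition rbasis c : M := (if c.2 then 'i else 1 : C) *: delta_mx c.1.1 c.1.2.

Lemma rcoordD c : {morph rcoord c : X Y / X + Y}.
Proof.
by case: c => [[i j] []] X Y; rewrite /rcoord /= mxE; case: (X i j); case: (Y i j).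
Qed.

Lemma rcoordN c : {morph rcoord c : X / - X}.
Proof. by case: c => [[i j] []] X; rewrite /rcoord /= mxE; case: (X i j). Qed.

Lemma rcoordB c : {morph rcoord c : X Y / X - Y}.
Proof. by move=> X Y; rewrite rcoordD rcoordN. Qed.

Lemma rcoord0 c : rcoord c 0 = 0.
Proof. by case: c => [[i j] []]; rewrite /rcoord /= mxE. Qed.

Lemma rcoordZ c (r : R) X : rcoord c (r%:C *: X) = r * rcoord c X.
Proof.
by case: c => [[i j] []]; rewrite /rcoord /= mxE; case: (X i j) => a b /=;
  rewrite mul0r ?subr0 ?addr0.
Qed.

Lemma rcoord_sum c I (r : seq I) (P : pred I) (F : I -> M) :
  rcoord c (\sum_(i <- r | P i) F i) = \sum_(i <- r | P i) rcoord c (F i).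
Proof. by apply: (big_morph _ (rcoordD c) (rcoord0 c)). Qed.

Lemma rcoord_inj X Y : (forall c, rcoord c X = rcoord c Y) -> X = Y.
Proof.
move=> h; apply/matrixP => i j.
have := h (i, j, false); have := h (i, j, true); rewrite /rcoord /=.
by case: (X i j) => a b; case: (Y i j) => a' b' /= -> ->.
Qed.

Lemma rcoord_rbasis X : X = \sum_c (rcoord c X)%:C *: rbasis c.
Proof.
rewrite [LHS]matrix_sum_delta pair_bigA /=.
rewrite -(pair_bigA _ (fun p b => (rcoord (p, b) X)%:C *: rbasis (p, b))) /=.
apply: eq_bigr => -[i j] _; rewrite big_bool /= /rcoord /rbasis /= !scalerA -scalerDl.
by congr (_ *: _); case: (X i j) => a b /=; simpc.
Qed.

(** Structure constants: continuity, measurability and derivability of a product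
    of matrix functions are read off from this formula. *)
Lemma rcoordM e X Y :
  rcoord e (X * Y) = \sum_c \sum_d rcoord c X * rcoord d Y * rcoord e (rbasis c * rbasis d).
Proof.
rewrite [in LHS](rcoord_rbasis X) [in LHS](rcoord_rbasis Y) mulr_suml rcoord_sum.
apply: eq_bigr => c _; rewrite mulr_sumr rcoord_sum; apply: eq_bigr => d _.
by rewrite -scalerAl -scalerAr !rcoordZ mulrA.
Qed.

(** The l1 modulus: it is submultiplicative like the usual one, while its sum over
    the entries is exactly the sum of the absolute values of the real coordinates. *)
Definition cabs (z : C) : R := `|complex.Re z| + `|complex.Im z|.

Lemma cabsM z w : cabs (z * w) <= cabs z * cabs w.
Proof.
case: z w => a b [u v]; rewrite /cabs /=.
rewrite mulrDl !mulrDr -!normrM.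
have := ler_normB (a * u) (b * v); have := ler_normD (a * v) (b * u); lra.
Qed.

Lemma cabsD z w : cabs (z + w) <= cabs z + cabs w.
Proof.
case: z w => a b [u v]; rewrite /cabs /=.
have := ler_normD a u; have := ler_normD b v; lra.
Qed.

Lemma cabs_ge0 z : 0 <= cabs z. Proof. by rewrite addr_ge0. Qed.

Lemma cabs0 : cabs 0 = 0. Proof. by rewrite /cabs normr0 addr0. Qed.

Lemma cabs1 : cabs 1 = 1. Proof. by rewrite /cabs normr0 normr1 addr0. Qed.

Lemma cabsX z k : cabs (z ^+ k) <= cabs z ^+ k.
Proof.
elim: k => [|k IH]; first by rewrite !expr0 cabs1.
by rewrite !exprS (le_trans (cabsM _ _))// ler_wpM2l ?cabs_ge0.
Qed.

Lemma cabs_sum I (r : seq I) (P : pred I) (F : I -> C) :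
  cabs (\sum_(i <- r | P i) F i) <= \sum_(i <- r | P i) cabs (F i).
Proof.
elim/big_rec2: _ => [|i u v _ h]; first by rewrite cabs0.
by rewrite (le_trans (cabsD _ _))// lerD2l.
Qed.

Fact nrm_key : unit. Proof. exact: tt. Qed.

Definition nrm : M -> R :=
  locked_with nrm_key (fun X => \sum_i \sum_j cabs (X i j)).

Lemma nrm_unlock X : nrm X = \sum_i \sum_j cabs (X i j).
Proof. by rewrite /nrm locked_withE. Qed.

Lemma nrm_ge0 X : 0 <= nrm X.
Proof. by rewrite nrm_unlock; apply: sumr_ge0 => i _; apply: sumr_ge0 => j _; exact: cabs_ge0. Qed.
Hint Resolve nrm_ge0 : core.

Lemma nrm0 : nrm 0 = 0.
Proof. by rewrite nrm_unlock; apply: big1 => i _; apply: big1 => j _; rewrite mxE cabs0. Qed.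

Lemma nrmE X : nrm X = \sum_c `|rcoord c X|.
Proof.
rewrite !nrm_unlock pair_bigA /= -(pair_bigA _ (fun p b => `|rcoord (p, b) X|)) /=.
by apply: eq_bigr => -[i j] _; rewrite big_bool /rcoord /= addrC.
Qed.

Lemma le_rcoord_nrm c X : `|rcoord c X| <= nrm X.
Proof. by rewrite nrmE (bigD1 c) //= lerDl sumr_ge0. Qed.

Lemma nrmD X Y : nrm (X + Y) <= nrm X + nrm Y.
Proof.
by rewrite !nrmE -big_split ler_sum// => c _; rewrite rcoordD ler_normD.
Qed.

Lemma nrmN X : nrm (- X) = nrm X.
Proof. by rewrite !nrmE; apply: eq_bigr => c _; rewrite rcoordN normrN. Qed.

Lemma nrmB X Y : nrm (X - Y) <= nrm X + nrm Y.
Proof. by rewrite -(nrmN Y) nrmD. Qed.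

Lemma nrmZ (r : R) X : nrm (r%:C *: X) = `|r| * nrm X.
Proof.
by rewrite !nrmE mulr_sumr; apply: eq_bigr => c _; rewrite rcoordZ normrM.
Qed.

Lemma nrmZc (z : C) X : nrm (z *: X) <= cabs z * nrm X.
Proof.
rewrite !nrm_unlock mulr_sumr ler_sum// => i _; rewrite mulr_sumr ler_sum// => j _.
by rewrite mxE cabsM.
Qed.

Lemma nrm_sum I (r : seq I) (P : pred I) (F : I -> M) :
  nrm (\sum_(i <- r | P i) F i) <= \sum_(i <- r | P i) nrm (F i).
Proof.
elim/big_rec2: _ => [|i u v _ h]; first by rewrite nrm0.
by rewrite (le_trans (nrmD _ _))// lerD2l.
Qed.

Lemma nrmM X Y : nrm (X * Y) <= nrm X * nrm Y.
Proof.
rewrite !nrm_unlock mulr_suml ler_sum// => i _; rewrite mulr_suml.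
apply: (@le_trans _ _ (\sum_j \sum_k cabs (X i k) * cabs (Y k j))).
  apply: ler_sum => j _; rewrite mxE (le_trans (cabs_sum _ _ _))// ler_sum//.
  by move=> k _; exact: cabsM.
rewrite exchange_big ler_sum// => k _; rewrite -mulr_sumr ler_wpM2l ?cabs_ge0//.
rewrite [leRHS](bigD1 k) //= lerDl sumr_ge0// => l _.
by apply: sumr_ge0 => j _; exact: cabs_ge0.
Qed.

Lemma nrmX X k : nrm (X ^+ k) <= nrm 1 * nrm X ^+ k.
Proof.
elim: k => [|k IH]; first by rewrite !expr0 mulr1.
by rewrite !exprS mulrCA (le_trans (nrmM _ _))// ler_wpM2l.
Qed.

Lemma nrm_eq0 X : nrm X = 0 -> X = 0.
Proof.
move=> h; apply: rcoord_inj => c; apply/eqP; rewrite rcoord0 -normr_le0 -h.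
exact: le_rcoord_nrm.
Qed.

Lemma nrm_scalar (r : R) : nrm (r%:C%:M) = `|r| * nrm 1.
Proof. by rewrite -nrmZ scalemx1. Qed.

End Components.
#[global] Hint Extern 0 (is_true (0 <= nrm _)) => solve [apply: nrm_ge0] : core.
#[global] Hint Extern 0 (is_true (0 <= cabs _)) => solve [apply: cabs_ge0] : core.

(** * Limits and derivatives of matrix functions *)

Section RealLemmas.
Context {R : realType}.

Lemma cvg_bigsum {T} (F : set_system T) {FF : Filter F} (I : Type) (r : seq I)
    (h : I -> T -> R) (l : I -> R) :
  (forall i, h i x @[x --> F] --> l i) ->
  \sum_(i <- r) h i x @[x --> F] --> \sum_(i <- r) l i.
Proof.
move=> hl; elim: r => [|i r IH].
  by rewrite big_nil; under eq_fun do rewrite big_nil; exact: cvg_cst.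
by rewrite big_cons; under eq_fun do rewrite big_cons; exact: cvgD.
Qed.

Lemma is_derive_bigsum (I : Type) (r : seq I) (h : I -> R -> R) (x : R) (dh : I -> R) :
  (forall i, is_derive x 1 (h i) (dh i)) ->
  is_derive x 1 (fun y => \sum_(i <- r) h i y) (\sum_(i <- r) dh i).
Proof.
move=> hd; elim: r => [|i r IH].
  by rewrite big_nil; under eq_fun do rewrite big_nil; exact: is_derive_cst.
rewrite big_cons; under eq_fun do rewrite big_cons.
exact: (@is_deriveD _ _ _ (h i)).
Qed.

Lemma is_derive1_continuous (f : R -> R) (x df : R) :
  is_derive x 1 f df -> {for x, continuous f}.
Proof.
by move=> [d _]; exact/differentiable_continuous/derivable1_diffP.
Qed.

Lemma is_derive_le (f g df dg : R -> R) (a b : R) : a <= b ->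
  (forall x, a <= x <= b -> is_derive x 1 f (df x)) ->
  (forall x, a <= x <= b -> is_derive x 1 g (dg x)) ->
  (forall x, a <= x <= b -> df x <= dg x) -> f b - f a <= g b - g a.
Proof.
move=> ab hf hg hle.
have hd x : a <= x <= b -> is_derive x 1 (g - f) (dg x - df x).
  by move=> hx; apply: is_deriveB; [exact: hg|exact: hf].
have [||c cab] := @MVT_segment R (g - f) (dg - df) a b ab.
- by move=> x; rewrite in_itv /= => /andP[/ltW ax /ltW xb]; apply: hd; rewrite ax xb.
- apply: continuous_in_subspaceT => x; rewrite inE /= in_itv /= => hx.
  exact: is_derive1_continuous (hd _ hx).
rewrite !fctE => e.
suff : 0 <= (dg c - df c) * (b - a) by rewrite -e; lra.
rewrite in_itv /= in cab.
by rewrite mulr_ge0 ?subr_ge0 ?hle.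
Qed.

Lemma is_derive_norm_le (f g df dg : R -> R) (a b : R) : a <= b ->
  (forall x, a <= x <= b -> is_derive x 1 f (df x)) ->
  (forall x, a <= x <= b -> is_derive x 1 g (dg x)) ->
  (forall x, a <= x <= b -> `|df x| <= dg x) -> `|f b - f a| <= g b - g a.
Proof.
move=> ab hf hg hle; rewrite ler_norml lerNl; apply/andP; split; last first.
  apply: (is_derive_le ab hf hg) => x /hle; exact/le_trans/ler_norm.
rewrite opprB -(opprK (f a)) addrC.
apply: (is_derive_le ab (f := - f) (df := - df)) hg _ => x hx.
  by apply: is_deriveN; exact: hf.
by rewrite (le_trans (ler_norm _))// fctE normrN hle.
Qed.

End RealLemmas.

Section MxLimits.
Context {R : realType} {n : nat}.
Local Notation C := R[i].
Local Notation M := 'M[C]_n.+1.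
Local Notation idx := ('I_n.+1 * 'I_n.+1 * bool)%type.
Implicit Types (c d e : idx) (X Y : M).

Definition mx_cvg {T} (F : set_system T) (f : T -> M) (L : M) : Prop :=
  forall c, rcoord c (f x) @[x --> F] --> rcoord c L.

Section Cvg.
Context {T : Type} {F : set_system T} {FF : ProperFilter F}.
Implicit Types f g : T -> M.

Lemma mx_cvg_cst X : mx_cvg F (fun=> X) X.
Proof. by move=> c; exact: cvg_cst. Qed.

#[global] Arguments mx_cvg_cst X : clear implicits.

Lemma mx_cvgD f g X Y : mx_cvg F f X -> mx_cvg F g Y -> mx_cvg F (fun x => f x + g x) (X + Y).
Proof.
by move=> hf hg c; rewrite rcoordD; under eq_fun do rewrite rcoordD; exact: cvgD.
Qed.

Lemma mx_cvgB f g X Y : mx_cvg F f X -> mx_cvg F g Y -> mx_cvg F (fun x => f x - g x) (X - Y).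
Proof.
by move=> hf hg c; rewrite rcoordB; under eq_fun do rewrite rcoordB; exact: cvgB.
Qed.

Lemma mx_cvgM f g X Y : mx_cvg F f X -> mx_cvg F g Y -> mx_cvg F (fun x => f x * g x) (X * Y).
Proof.
move=> hf hg e; rewrite rcoordM; under eq_fun do rewrite rcoordM.
apply: cvg_bigsum => c; apply: cvg_bigsum => d.
by apply: cvgM; [exact: cvgM|exact: cvg_cst].
Qed.

Lemma mx_cvgZ (r : T -> R) (l : R) f X : r x @[x --> F] --> l -> mx_cvg F f X ->
  mx_cvg F (fun x => (r x)%:C *: f x) (l%:C *: X).
Proof.
by move=> hr hf c; rewrite rcoordZ; under eq_fun do rewrite rcoordZ; exact: cvgM.
Qed.

Lemma mx_cvg_unique f X Y : mx_cvg F f X -> mx_cvg F f Y -> X = Y.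
Proof.
move=> hX hY; apply: rcoord_inj => c.
rewrite -(cvg_lim (@norm_hausdorff _ _) (hX c)).
by rewrite -(cvg_lim (@norm_hausdorff _ _) (hY c)).
Qed.

Lemma mx_cvg_nrm f X : mx_cvg F f X -> nrm (f x) @[x --> F] --> nrm X.
Proof.
move=> hf; rewrite nrmE; under eq_fun do rewrite nrmE.
by apply: cvg_bigsum => c; apply: cvg_norm.
Qed.

Lemma mx_cvg_nrm0 f : nrm (f x) @[x --> F] --> 0 -> mx_cvg F f 0.
Proof.
move=> h c; rewrite rcoord0; apply: norm_cvg0.
apply: (@squeeze_cvgr _ F _ R (fun=> 0) (fun x => nrm (f x))) h.
  by apply: nearW => x; rewrite normr_ge0 le_rcoord_nrm.
exact: cvg_cst.
Qed.

Lemma mx_cvg_le f X (r : T -> R) : (forall x, nrm (f x - X) <= r x) ->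
  r x @[x --> F] --> 0 -> mx_cvg F f X.
Proof.
move=> hr h0.
have : mx_cvg F (fun x => f x - X) 0.
  apply: mx_cvg_nrm0; apply: (@squeeze_cvgr _ F _ R (fun=> 0) r) h0.
    by apply: nearW => x; rewrite nrm_ge0 hr.
  exact: cvg_cst.
move=> h; have := mx_cvgD h (mx_cvg_cst X).
by rewrite add0r; under eq_fun do rewrite subrK.
Qed.

End Cvg.

(** Links coordinatewise limits with the limits in the topology of matrices by
    which the exponential and the hypergeometric series are defined. *)
Lemma mx_cvg_lim (u : nat -> M) X : mx_cvg \oo u X -> limn u = X.
Proof.
move=> h; apply: cvg_lim; first exact: norm_hausdorff.
apply/cvg_ballP => e e0.
have /complex_realP[r er] := gtr0_real e0.
rewrite er in e0 *.
have r0 : 0 < r by rewrite -ltcR.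
have hr c : \forall k \near \oo, `|rcoord c X - rcoord c (u k)| < r / 2.
  have /cvgrPdist_lt := h c; apply; lra.
have /filter_forall hall := hr.
have : \forall k \near \oo, forall c, `|rcoord c X - rcoord c (u k)| < r / 2 by exact: hall.
apply: filterS => k hk; split => // i j.
rewrite -ball_normE /= normc_def ltcR.
have := hk (i, j, false); have := hk (i, j, true); rewrite /rcoord /=.
case: (X i j) (u k i j) => a b [a' b'] /=.
set s := a - a'; set t := b - b' => ht hs.
have h1 : (s ^+ 2 + t ^+ 2) < r ^+ 2.
  by move: ht hs; rewrite !ltr_norml => /andP[? ?] /andP[? ?]; nra.
rewrite -(ltr_pXn2r (n := 2)) ?nnegrE ?sqrtr_ge0 ?(ltW r0)// sqr_sqrtr//.
by rewrite addr_ge0 ?sqr_ge0.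
Qed.

(** The Weierstrass test; the bound on the partial sums makes them dominated when
    they are integrated. *)
Lemma mx_cvg_series (u : nat -> M) (v : nat -> R) :
  (forall k, nrm (u k) <= v k) -> cvgn (series v) ->
  exists L, [/\ mx_cvg \oo (series u) L & forall k, nrm (series u k) <= limn (series v)].
Proof.
move=> huv cv.
have v0 k : 0 <= v k by exact: le_trans (nrm_ge0 _) (huv k).
have cc c : cvgn (series (fun k => rcoord c (u k))).
  apply: normed_cvg; apply: series_le_cvg cv => [k|//|k]; first exact: normr_ge0.
  exact: le_trans (le_rcoord_nrm _ _) (huv k).
pose L := \sum_c (limn (series (fun k => rcoord c (u k))))%:C *: @rbasis R n c.
have rcoordL c : rcoord c L = limn (series (fun k => rcoord c (u k))).
  rewrite /L.
  have hb d : rcoord c (rbasis d : M) = (c == d)%:R.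
    case: c d => [[i j] b] [[i' j'] b']; rewrite /rcoord /rbasis /= !mxE !xpair_eqE.
    by case: b; case: b' => /=; case: (i == i') => /=; case: (j == j') => /=;
      simpc.
  rewrite rcoord_sum (bigD1 c) //= rcoordZ hb eqxx mulr1 big1 ?addr0// => d dc.
  by rewrite rcoordZ hb eq_sym (negbTE dc) mulr0.
exists L; split.
  move=> c; rewrite rcoordL; have := cc c.
  by under [in X in _ -> X]eq_fun do rewrite /series /= rcoord_sum.
move=> k; rewrite /series /=.
apply: le_trans (nrm_sum _ _ _) _.
apply: (@le_trans _ _ (series v k)); first by rewrite /series /= ler_sum.
by apply: nondecreasing_cvgn_le => //; exact: nondecreasing_series.
Qed.

Definition mx_der (f : R -> M) (x : R) (f' : M) : Prop :=
  forall c, is_derive x 1 (fun y => rcoord c (f y)) (rcoord c f').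

Lemma mx_der_eq f x X Y : mx_der f x X -> X = Y -> mx_der f x Y.
Proof. by move=> h <-. Qed.

Lemma mx_der_cst X x : mx_der (fun=> X) x 0.
Proof. by move=> c; rewrite rcoord0; exact: is_derive_cst. Qed.

#[global] Arguments mx_der_cst X x : clear implicits.

Lemma mx_derD f g x X Y : mx_der f x X -> mx_der g x Y -> mx_der (fun y => f y + g y) x (X + Y).
Proof.
move=> hf hg c; rewrite rcoordD; under eq_fun do rewrite rcoordD.
exact: (@is_deriveD _ _ _ (fun y => rcoord c (f y))).
Qed.

Lemma mx_derM f g x X Y : mx_der f x X -> mx_der g x Y ->
  mx_der (fun y => f y * g y) x (X * g x + f x * Y).
Proof.
move=> hf hg e; rewrite rcoordD !rcoordM -big_split /=; under eq_fun do rewrite rcoordM.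
apply: is_derive_bigsum => c; rewrite -big_split /=; apply: is_derive_bigsum => d.
pose k := rcoord e (rbasis c * rbasis d : M).
have h := is_deriveM (hf c) (hg d).
have := is_deriveM h (is_derive_cst k x 1).
move=> h'; apply: is_derive_eq.
by rewrite /k !fctE /= scaler0 add0r /GRing.scale /=; ring.
Qed.

Lemma mx_derZ (r : R -> R) (f : R -> M) (x r' : R) X : is_derive x 1 r r' -> mx_der f x X ->
  mx_der (fun y => (r y)%:C *: f y) x (r'%:C *: f x + (r x)%:C *: X).
Proof.
move=> hr hf c; rewrite rcoordD !rcoordZ; under eq_fun do rewrite rcoordZ.
have h := is_deriveM hr (hf c); apply: is_derive_eq.
by rewrite /GRing.scale /=; ring.
Qed.

Lemma mx_der_comp (f : R -> M) (g : R -> R) (x : R) X (g' : R) :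
  mx_der f (g x) X -> is_derive x 1 g g' ->
  mx_der (fun y => f (g y)) x (g'%:C *: X).
Proof.
move=> hf hg c; rewrite rcoordZ mulrC.
exact: (@is_derive1_comp _ (fun y => rcoord c (f y))).
Qed.

Lemma mx_der_continuous f x X : mx_der f x X -> mx_cvg (nbhs x) f (f x).
Proof. by move=> h c; exact: is_derive1_continuous (h c). Qed.

Definition ncoord : R := #|{: idx}|%:R.

Lemma ncoord_ge0 : 0 <= ncoord. Proof. exact: ler0n. Qed.

(** The mean value inequality is applied to each real coordinate separately, which
    costs the factor [ncoord]. *)
Lemma mx_der_le (f f' : R -> M) (g g' : R -> R) (a b : R) : a <= b ->
  (forall x, a <= x <= b -> mx_der f x (f' x)) ->
  (forall x, a <= x <= b -> is_derive x 1 g (g' x)) ->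
  (forall x, a <= x <= b -> nrm (f' x) <= g' x) ->
  nrm (f b - f a) <= ncoord * (g b - g a).
Proof.
move=> ab hf hg hle; rewrite nrmE.
rewrite /ncoord mulr_natl -sumr_const ler_sum// => c _; rewrite rcoordB.
apply: (is_derive_norm_le ab (fun x hx => hf x hx c) hg) => x /hle.
exact/le_trans/le_rcoord_nrm.
Qed.

Lemma mx_der0_cst f : (forall x, mx_der f x 0) -> forall x y, f x = f y.
Proof.
move=> h x y; apply: rcoord_inj => c.
by apply: (@is_derive_0_is_cst _ (fun y => rcoord c (f y))) => z; rewrite -(rcoord0 c); exact: h.
Qed.

End MxLimits.

(** * The matrix exponential *)

(** The derivative computed in [mexp_decay_annihilated]. *)
Lemma growth_alg (T : pzRingType) (L G E X Y : T) : L * G = G * L -> L * E = E * L ->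
  X * E = E * X ->
  L * G * (E * Y) + G * (- (X * E) * Y + E * 0) = - (G * (E * ((X - L) * Y))).
Proof.
move=> lg le xe; rewrite mulr0 addr0 xe lg -(mulrA G) (mulrA L) le.
by rewrite mulNr mulrN mulrBl !mulrBr opprB !mulrA.
Qed.

Lemma mulKlr (T : pzRingType) (a b e : T) : a * b = 1 -> e = a * (b * e).
Proof. by move=> h; rewrite mulrA h mul1r. Qed.

Section Exponential.
Context {R : realType} {n : nat}.
Local Notation C := R[i].
Local Notation M := 'M[C]_n.+1.
Implicit Types (X Y : M) (s t : R).

Lemma commM_r X Y : GRing.comm X Y -> X * Y = Y * X. Proof. by []. Qed.

Lemma comm_scalar (z : C) X : GRing.comm z%:M X.
Proof. by rewrite /GRing.comm -scalemx1 -scalerAl -scalerAr mul1r mulr1. Qed.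

Fact mexp_key : unit. Proof. exact: tt. Qed.

Definition mexp : M -> R -> M :=
  locked_with mexp_key (fun X s => mx_exp (s%:C *: X)).

Lemma mexpE X s : mexp X s = mx_exp (s%:C *: X).
Proof. by rewrite /mexp locked_withE. Qed.

(** Convergence and growth bound share the majorant series [|s| ^ k |X| ^ k / k!]. *)
Lemma mexp_spec X s :
  mx_cvg \oo (series (fun k => (s ^+ k / k`!%:R)%:C *: X ^+ k)) (mexp X s) /\
  nrm (mexp X s) <= nrm (1 : M) * expR (`|s| * nrm X).
Proof.
have vE : (fun k => nrm (1 : M) * exp_coeff (`|s| * nrm X) k) =
    nrm (1 : M) *: exp_coeff (`|s| * nrm X) :> (nat -> R) by apply/funext.
have [|| L [hL bL]] := @mx_cvg_series R n (fun k => (s ^+ k / k`!%:R)%:C *: X ^+ k)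
  (fun k => nrm (1 : M) * exp_coeff (`|s| * nrm X) k).
- move=> k; rewrite nrmZ /exp_coeff /= exprMn.
  rewrite normrM normrX normfV (ger0_norm (ler0n _ _)).
  have -> : nrm (1 : M) * (`|s| ^+ k * nrm X ^+ k / k`!%:R) =
      `|s| ^+ k / k`!%:R * (nrm (1 : M) * nrm X ^+ k) by ring.
  by apply: ler_wpM2l (nrmX _ _); rewrite mulr_ge0 ?exprn_ge0 ?invr_ge0 ?ler0n.
- by rewrite vE; apply: is_cvg_seriesZ; exact: is_cvg_series_exp_coeff.
have eL : mexp X s = L.
  rewrite -(mx_cvg_lim hL) mexpE /mx_exp; congr (limn (series _)).
  apply/funext => k; rewrite exprZn scalerA; congr (_ *: _).
  by rewrite rmorphM /= rmorphXn /= fmorphV rmorph_nat mulrC.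
rewrite eL; split => //.
have h : nrm (series (fun k => (s ^+ k / k`!%:R)%:C *: X ^+ k) k) @[k --> \oo] --> nrm L.
  exact: mx_cvg_nrm hL.
suff : limn (fun k => nrm (series (fun k => (s ^+ k / k`!%:R)%:C *: X ^+ k) k))
   <= nrm (1 : M) * expR (`|s| * nrm X).
  by rewrite (cvg_lim (@norm_hausdorff _ _) h).
apply: limr_le; first by apply/cvg_ex; eexists; exact: h.
apply: nearW => k; apply: le_trans (bL k) _.
by rewrite vE lim_seriesZ//; exact: is_cvg_series_exp_coeff.
Qed.

Lemma mexp_cvg X s :
  mx_cvg \oo (series (fun k => (s ^+ k / k`!%:R)%:C *: X ^+ k)) (mexp X s).
Proof. by have [] := mexp_spec X s. Qed.
#[global] Arguments mexp_cvg X s : clear implicits.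

Lemma nrm_mexp X s : nrm (mexp X s) <= nrm (1 : M) * expR (`|s| * nrm X).
Proof. by have [] := mexp_spec X s. Qed.

Lemma mexp_pseries X Y c s :
  pseries (fun k => rcoord c (Y * X ^+ k) / k`!%:R) s @ \oo --> rcoord c (Y * mexp X s).
Proof.
have -> : pseries (fun k => rcoord c (Y * X ^+ k) / k`!%:R) s =
    (fun k => rcoord c (Y * series (fun k => (s ^+ k / k`!%:R)%:C *: X ^+ k) k)).
  apply/funext => k.
  rewrite /pseries /series /= mulr_sumr rcoord_sum; apply: eq_bigr => j _.
  by rewrite -scalerAr rcoordZ; ring.
exact: (mx_cvgM (mx_cvg_cst Y) (mexp_cvg X s)).
Qed.

(** Each coordinate of [mexp X] is a real power series, so that the theorem on
    termwise differentiation of power series applies. *)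
Lemma mexp_der X s : mx_der (mexp X) s (X * mexp X s).
Proof.
move=> c.
pose a Y := fun k => rcoord c (Y * X ^+ k) / k`!%:R.
have aE Y r : limn (pseries (a Y) r) = rcoord c (Y * mexp X r).
  exact: (cvg_lim (@norm_hausdorff _ _) (@mexp_pseries X Y c r)).
have ca Y r : cvgn (pseries (a Y) r).
  by apply/cvg_ex; exists (rcoord c (Y * mexp X r)); exact: mexp_pseries.
have da Y : pseries_diffs (a Y) = a (Y * X).
  apply/funext => k; rewrite /pseries_diffs /a factS natrM exprS [Y * _]mulrA.
  by rewrite invfM mulrCA (mulrA k.+1%:R) divff ?pnatr_eq0// mul1r.
have := @pseries_snd_diffs R (a 1) (`|s| + 1) s.
rewrite !da mul1r => /(_ (ca _ _) (ca _ _) (ca _ _)).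
have -> : `|s| < `|(`|s| + 1)| by rewrite [ltRHS]ger0_norm ?addr_ge0// ltrDl.
rewrite aE => /(_ isT); congr (is_derive _ _ _ _).
by apply/funext => r; rewrite aE mul1r.
Qed.

#[global] Arguments mexp_der X s : clear implicits.

Lemma mexp_comm X Y s : GRing.comm Y X -> GRing.comm Y (mexp X s).
Proof.
move=> h; apply: (@mx_cvg_unique _ _ _ \oo _
    (fun k => Y * series (fun k => (s ^+ k / k`!%:R)%:C *: X ^+ k) k)).
  by apply: mx_cvgM (mexp_cvg X s); exact: mx_cvg_cst.
pose proof (mx_cvgM (mexp_cvg X s) (mx_cvg_cst Y)) as h'; move: h'.
congr (mx_cvg _ _ _); apply/funext => k; rewrite /series /= mulr_suml mulr_sumr.
apply: eq_bigr => j _; rewrite -scalerAl -scalerAr.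
by congr (_ *: _); apply/esym; exact: commrX.
Qed.

Lemma mexp0 X : mexp X 0 = 1.
Proof.
apply: (@mx_cvg_unique _ _ _ \oo _ _ _ _ (mexp_cvg X 0)) => c.
rewrite -(@cvg_shiftS _); under eq_fun => k.
  rewrite /series /= big_nat_recl//= expr0 fact0 invr1 mulr1 scale1r.
  rewrite big1; last by move=> i _; rewrite exprS !mul0r scale0r.
  rewrite addr0.
  over.
exact: cvg_cst.
Qed.

Lemma mexp_derN X s : mx_der (fun r => mexp X (- r)) s (- (X * mexp X (- s))).
Proof.
have := @mx_der_comp R n (mexp X) (-%R) s _ (-1) (mexp_der X (- s)) _.
move=> h; apply: mx_der_eq; first exact: h.
by rewrite rmorphN1 scaleN1r.
Qed.

#[global] Arguments mexp_derN X s : clear implicits.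

Lemma mexpNK X s : mexp X (- s) * mexp X s = 1.
Proof.
rewrite (@mx_der0_cst R n (fun s => mexp X (- s) * mexp X s) _ s 0).
  by rewrite oppr0 mexp0 mulr1.
move=> r; apply: mx_der_eq; first exact: (mx_derM (mexp_derN X r) (mexp_der X r)).
rewrite mulNr mulrA (commM_r (mexp_comm _ (commr_refl X))).
by rewrite addrC subrr.
Qed.

Lemma mexpKN X s : mexp X s * mexp X (- s) = 1.
Proof. by rewrite -{1}(opprK s) mexpNK. Qed.

(** Uniqueness for the linear equation: [mexp X (- s) * F s] is constant. *)
Lemma mexp_uniq X (F : R -> M) : (forall s, mx_der F s (X * F s)) ->
  forall s, F s = mexp X s * F 0.
Proof.
move=> h s.
have e : mexp X (- s) * F s = F 0.
  rewrite (@mx_der0_cst R n (fun s => mexp X (- s) * F s) _ s 0).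
    by rewrite oppr0 mexp0 mul1r.
  move=> r; apply: mx_der_eq; first exact: (mx_derM (mexp_derN X r) (h r)).
  by rewrite mulrA (commM_r (mexp_comm _ (commr_refl X))) !mulNr addNr.
by rewrite -e mulrA mexpKN mul1r.
Qed.

Lemma mexpD X s t : mexp X (s + t) = mexp X s * mexp X t.
Proof.
rewrite (@mexp_uniq X (fun r => mexp X (r + t))) ?add0r// => r.
have hd : is_derive r 1 (fun r => r + t) 1.
  by apply: is_derive_eq; rewrite addr0.
have := mx_der_comp (g := fun r => r + t) (mexp_der X (r + t)) hd.
by rewrite scale1r.
Qed.

Lemma mexp_add X Y s : GRing.comm X Y -> mexp (X + Y) s = mexp X s * mexp Y s.
Proof.
move=> h; rewrite [RHS](@mexp_uniq (X + Y) (fun r => mexp X r * mexp Y r)).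
  by rewrite !mexp0 !mulr1.
move=> r; apply: mx_der_eq; first exact: (mx_derM (mexp_der X r) (mexp_der Y r)).
rewrite mulrDl !mulrA; congr (_ + _ * _).
by apply/esym; exact: mexp_comm.
Qed.

Lemma mexp_real r s : mexp (r%:C%:M) s = (expR (r * s))%:C%:M.
Proof.
rewrite -[RHS]scalemx1 (@mexp_uniq (r%:C%:M) (fun s => (expR (r * s))%:C *: 1)).
  by rewrite mulr0 expR0 scale1r mulr1.
move=> t.
have hd : is_derive t 1 (fun s => expR (r * s)) (r * expR (r * t)).
  have h : is_derive t 1 (fun s => r * s) r.
    have := is_deriveZ r (is_derive_id t 1); by rewrite /GRing.scale /= mulr1.
  by rewrite mulrC; exact: (@is_derive1_comp _ expR).
have := mx_derZ hd (mx_der_cst (1 : M) t); rewrite scaler0 addr0.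
by move=> h; apply: mx_der_eq h _; rewrite -scalemx1 -scalerAl mul1r scalerA rmorphM.
Qed.

Lemma mexp_imag (th s : R) : mexp ((0 +i* th)%:M) s =
  (cos (th * s))%:C *: 1 + (sin (th * s))%:C *: ('i)%:M.
Proof.
rewrite [RHS](@mexp_uniq ((0 +i* th)%:M) (fun s =>
   (cos (th * s))%:C *: 1 + (sin (th * s))%:C *: ('i)%:M)).
  by rewrite mulr0 cos0 sin0 scale1r scale0r addr0 mulr1.
move=> t.
have h : is_derive t 1 (fun s => th * s) th.
  by have := is_deriveZ th (is_derive_id t 1); rewrite /GRing.scale /= mulr1.
have hc : is_derive t 1 (fun s => cos (th * s)) (- sin (th * t) * th).
  exact: (@is_derive1_comp _ cos).
have hs : is_derive t 1 (fun s => sin (th * s)) (cos (th * t) * th).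
  exact: (@is_derive1_comp _ sin).
have := mx_derD (mx_derZ hc (mx_der_cst (1 : M) t)) (mx_derZ hs (mx_der_cst (('i)%:M : M) t)).
rewrite !scaler0 !addr0 => h'; apply: mx_der_eq h' _.
have si (z : C) : z%:M = z *: 1 :> M by rewrite scalemx1.
rewrite (si 'i) (si (0 +i* th)) mulrDr -!scalerAl !mul1r !scalerA -!scalerDl.
by congr (_ *: _); simpc; congr (_ +i* _); ring.
Qed.

(** The real part of [l] contributes an exponential, the imaginary part a rotation
    whose norm stays bounded. *)
Lemma nrm_mexp_scalar (l : C) :
  exists2 K, 0 <= K &
    forall s, nrm (mexp (l%:M : M) s) <= K * expR (complex.Re l * s).
Proof.
exists (nrm (1 : M) + nrm (('i)%:M : M)) => [|s]; first exact: addr_ge0.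
have -> : (l%:M : M) = (complex.Re l)%:C%:M + (0 +i* complex.Im l)%:M.
  by rewrite -raddfD; case: l => a b /=; simpc.
rewrite mexp_add; last exact: comm_scalar.
rewrite mexp_real mexp_imag -[_%:M]scalemx1 -scalerAl mul1r nrmZ.
rewrite ger0_norm ?expR_ge0// mulrC ler_wpM2r ?expR_ge0//.
apply: le_trans (nrmD _ _) _; rewrite !nrmZ.
by rewrite lerD// ler_piMl// ler_norml ?cos_geN1 ?cos_le1 ?sin_geN1 ?sin_le1.
Qed.

(** Each factor is removed by integrating [e^{ls} e^{-sX} Y], whose derivative is
    [- e^{ls} e^{-sX} (X - l) Y]. *)
Lemma mexp_decay_annihilated X (a : R) (rs : seq C) :
  (forall l, l \in rs -> a < complex.Re l) ->
  forall Y, horner_mx X (\prod_(l <- rs) ('X - l%:P)) * Y = 0 ->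
  exists2 K, 0 <= K & forall s, 0 <= s -> nrm (mexp X (- s) * Y) <= K * expR (- (a * s)).
Proof.
elim: rs => [_ Y|l rs IH hrs Y].
  rewrite big_nil rmorph1 mul1r => ->; exists 0 => // s _.
  by rewrite mulr0 nrm0 mul0r.
rewrite big_cons mulrC rmorphM rmorphB /= horner_mx_X horner_mx_C -mulrA => hY.
have [|K K0 hK] := IH _ _ hY.
  by move=> l' hl'; apply: hrs; rewrite in_cons hl' orbT.
have hl : a < complex.Re l by apply: hrs; rewrite mem_head.
have [K1 K10 hK1] := nrm_mexp_scalar l.
set b := complex.Re l - a; have b0 : 0 < b by rewrite subr_gt0.
pose g s := mexp (l%:M) s * (mexp X (- s) * Y).
have dg s : mx_der g s (- (mexp (l%:M) s * (mexp X (- s) * ((X - l%:M) * Y)))).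
  have h1 := mx_derM (mexp_derN X s) (mx_der_cst Y s).
  have h := mx_derM (mexp_der (l%:M) s) h1; apply: mx_der_eq h _.
  by apply: growth_alg; [exact: mexp_comm (commr_refl _)|exact: comm_scalar|
    exact: mexp_comm (commr_refl _)].
have hg s : 0 <= s -> nrm (g s - g 0) <=
    @ncoord R n * (K1 * K / b * expR (b * s) - K1 * K / b * expR (b * 0)).
  move=> s0; apply: (mx_der_le (f := g) (g := fun r => K1 * K / b * expR (b * r)) s0 (f' := fun s =>
     - (mexp (l%:M) s * (mexp X (- s) * ((X - l%:M) * Y))))
     (g' := fun s => K1 * K * expR (b * s))) => r /andP[r0 rs'].
  - exact: dg.
  - have h : is_derive r 1 (fun s => b * s) b.
      by have := is_deriveZ b (is_derive_id r 1); rewrite /GRing.scale /= mulr1.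
    have h1 : is_derive r 1 (fun s => expR (b * s)) (expR (b * r) * b).
      exact: (@is_derive1_comp _ expR).
    have := is_deriveZ (K1 * K / b) h1; rewrite /GRing.scale /= => h2.
    by apply: is_derive_eq; rewrite /GRing.scale /=; field; rewrite gt_eqF.
  - rewrite nrmN (le_trans (nrmM _ _))//.
    rewrite (_ : b * r = complex.Re l * r + - (a * r)); last by rewrite /b; ring.
    rewrite expRD mulrACA ler_pM//; exact: hK.
set K2 := @ncoord R n * (K1 * K / b) + nrm Y.
have K20 : 0 <= K2.
  by rewrite addr_ge0// mulr_ge0 ?ncoord_ge0// !mulr_ge0// invr_ge0 ltW.
have gb s : 0 <= s -> nrm (g s) <= K2 * expR (b * s).
  move=> s0; have := hg s s0; rewrite mulr0 expR0 mulr1.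
  have -> : g 0 = Y by rewrite /g oppr0 !mexp0 !mul1r.
  move=> h; rewrite -(subrK Y (g s)); apply: le_trans (nrmD _ _) _.
  have e1 : 1 <= expR (b * s) by rewrite -expR0 ler_expR mulr_ge0// ltW.
  have p1 : 0 <= @ncoord R n * (K1 * K / b).
    by rewrite mulr_ge0 ?ncoord_ge0// !mulr_ge0// invr_ge0 ltW.
  have p2 := nrm_ge0 Y.
  rewrite /K2 mulrDl; apply: lerD; last by rewrite ler_peMr.
  by apply: le_trans h _; rewrite mulrBr mulrA; lra.
exists (K1 * K2) => [|s s0]; first by rewrite mulr_ge0.
have -> : mexp X (- s) * Y = mexp (l%:M) (- s) * g s.
  exact: (mulKlr _ (mexpNK (l%:M) s)).
apply: le_trans (nrmM _ _) _.
have -> : - (a * s) = complex.Re l * - s + b * s by rewrite /b; ring.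
by rewrite expRD mulrACA ler_pM// gb.
Qed.

(** Cayley-Hamilton makes [mexp_decay_annihilated] applicable with [Y = 1]. *)
Lemma mexp_decay X (a : R) : (forall l, eigenvalue X l -> a < complex.Re l) ->
  exists2 K, 0 <= K & forall s, 0 <= s -> nrm (mexp X (- s)) <= K * expR (- (a * s)).
Proof.
move=> ha; have [rs hrs] := closed_field_poly_normal (char_poly X).
have lc : lead_coef (char_poly X) = 1 by apply/monicP; exact: char_poly_monic.
rewrite lc scale1r in hrs.
have [||K K0 hK] := @mexp_decay_annihilated X a rs _ 1.
- move=> l lrs; apply: ha; rewrite eigenvalue_root_char hrs.
  by rewrite root_prod_XsubC.
- by rewrite mulr1 -hrs Cayley_Hamilton.
by exists K => // s s0; rewrite -[mexp _ _]mulr1 hK.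
Qed.

(** There are finitely many eigenvalues, so their real parts have a positive lower
    bound. *)
Lemma positive_stable_decay X : positive_stable X ->
  exists a, 0 < a /\ exists2 K, 0 <= K &
    forall s, 0 <= s -> nrm (mexp X (- s)) <= K * expR (- (a * s)).
Proof.
move=> hX; have [rs hrs] := closed_field_poly_normal (char_poly X).
have lc : lead_coef (char_poly X) = 1 by apply/monicP; exact: char_poly_monic.
rewrite lc scale1r in hrs.
have rsE l : (l \in rs) = eigenvalue X l.
  by rewrite eigenvalue_root_char hrs root_prod_XsubC.
have [a a0 ha] : exists2 a, 0 < a & forall l, l \in rs -> a < complex.Re l.
  have : forall l, l \in rs -> 0 < complex.Re l by move=> l; rewrite rsE; exact: hX.
  elim: (rs) => [_|l r IH h]; first by exists 1.
  have [|a a0 ha] := IH; first by move=> l' hl'; apply: h; rewrite in_cons hl' orbT.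
  have l0 : 0 < complex.Re l by apply: h; rewrite mem_head.
  exists (Num.min a (complex.Re l) / 2) => [|l'].
    by rewrite divr_gt0// lt_min a0.
  have m1 : Num.min a (complex.Re l) <= a by rewrite ge_min lexx.
  have m2 : Num.min a (complex.Re l) <= complex.Re l by rewrite ge_min lexx orbT.
  have m0 : 0 < Num.min a (complex.Re l) by rewrite lt_min a0.
  rewrite in_cons => /orP[/eqP->|/ha]; lra.
by exists a; split => //; apply: mexp_decay => l; rewrite -rsE; exact: ha.
Qed.

End Exponential.

(** * Integrals of real functions *)

Section RealIntegrals.
Context {R : realType}.
Local Notation mu := (@lebesgue_measure R).
Implicit Types (D : set R) (f g F : R -> R).

Definition Rintegrable D f : Prop := mu.-integrable D (fun x => (f x)%:E).

Definition Rint D f : R := \int[mu]_(x in D) f x.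

Lemma meas_EFin D f :
  measurable_fun D (fun x => (f x)%:E) <-> measurable_fun D f.
Proof. exact: (@measurable_EFinP _ _ _ D f). Qed.

Lemma Rintegrable_measurable D f : Rintegrable D f -> measurable_fun D f.
Proof. by move=> /integrableP[/meas_EFin]. Qed.

Lemma Rintegrable_le D f g : measurable D -> measurable_fun D f ->
  (forall x, D x -> `|f x| <= g x) -> Rintegrable D g -> Rintegrable D f.
Proof.
move=> mD mf fg; apply: le_integrable => //; first exact/meas_EFin.
by move=> x Dx; rewrite /= lee_fin (le_trans (fg _ Dx))// ler_norm.
Qed.

Lemma Rintegrable_lin D (I : Type) (r : seq I) (k : I -> R) (h : I -> R -> R) : measurable D ->
  (forall i, Rintegrable D (h i)) ->
  Rintegrable D (fun x => \sum_(i <- r) k i * h i x) /\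
  Rint D (fun x => \sum_(i <- r) k i * h i x) = \sum_(i <- r) k i * Rint D (h i).
Proof.
move=> mD hi; elim: r => [|i r [IH1 IH2]].
  rewrite big_nil /Rintegrable /Rint; under eq_fun do rewrite big_nil.
  split; first exact: integrable0.
  under eq_Rintegral do rewrite big_nil.
  by rewrite Rintegral_cst// mul0r.
have h1 : Rintegrable D (fun x => k i * h i x) 
  by rewrite /Rintegrable; under eq_fun do rewrite EFinM; exact: integrableZl (hi i).
rewrite big_cons /Rintegrable /Rint; under eq_fun do rewrite big_cons.
split.
  by under eq_fun do rewrite EFinD; exact: integrableD.
under eq_Rintegral do rewrite big_cons.
rewrite RintegralD//; congr (_ + _); last exact: IH2.
by rewrite RintegralZl//; exact: hi.
Qed.

Lemma Rint_dct D (f_ : nat -> R -> R) f g : measurable D ->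
  (forall n, measurable_fun D (f_ n)) ->
  (forall x, D x -> f_ n x @[n --> \oo] --> f x) -> Rintegrable D g ->
  (forall n x, D x -> `|f_ n x| <= g x) ->
  Rintegrable D f /\ Rint D (f_ n) @[n --> \oo] --> Rint D f.
Proof.
move=> mD mf hf ig fg.
have mlim : measurable_fun D f by exact: (measurable_fun_cvg mf).
have ifn n : Rintegrable D (f_ n) by exact: (Rintegrable_le mD (mf n) (fg n)).
have [||||| i1 _ i3] := @dominated_convergence _ _ R mu D mD
  (fun n x => (f_ n x)%:E) (fun x => (f x)%:E) (fun x => (g x)%:E).
- by move=> n; apply/meas_EFin.
- by apply/meas_EFin.
- by apply/aeW => x Dx; apply: cvg_EFin; [exact: nearW|exact: hf].
- by [].
- by apply/aeW => x n Dx; rewrite /= lee_fin fg.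
split => //.
rewrite /Rint /Rintegral; apply: fine_cvg.
by rewrite fineK//; exact: integrable_fin_num.
Qed.

(** Affine change of variables; the pushforward of the measure is identified on
    half-open intervals.  *)
Lemma lebesgue_affine (a b : R) : 0 < a -> forall A : set R, measurable A ->
  mu A = (a%:E * mu ((fun u => b + a * u)%R @^-1` A))%E.
Proof.
move=> a0 A mA.
pose phi : measurableTypeR R -> measurableTypeR R := fun u => b + a * u.
have mphi : measurable_fun setT phi.
  by apply: measurable_funD => //; exact: measurable_funM.
have H := @lebesgue_measure_unique R (mscale (NngNum (ltW a0)) (pushforward mu phi)).
rewrite (H mphi)// => _ [[c d]] _ <-.
have E : phi @^-1` [set` `]c, d]] = [set` `](c - b) / a, (d - b) / a]].
  apply/seteqP; split => u; rewrite /phi /= !in_itv /= ltr_pdivrMr// ler_pdivlMr// => /andP[h1 h2].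
    by apply/andP; split; lra.
  by apply/andP; split; lra.
pose I : set R := [set` `](c - b) / a, (d - b) / a]].
transitivity (a%:E * mu I)%E; last by rewrite /I -E.
rewrite /I !lebesgue_measure_itv /= !lte_fin ltr_pM2r ?invr_gt0// ltrD2r.
case: ifP => _; last by rewrite mule0.
rewrite -!EFinB -EFinM; congr EFin; field; lra.
Qed.

Lemma ge0_integral_affine (a b : R) D (f : R -> \bar R) : 0 < a -> measurable D ->
  measurable_fun D f -> (forall y, 0 <= f y)%E ->
  (\int[mu]_(y in D) f y =
   a%:E * \int[mu]_(x in (fun u => b + a * u)%R @^-1` D) f (b + a * x)%R)%E.
Proof.
move=> a0 mD mf f0.
pose phi : measurableTypeR R -> measurableTypeR R := fun u => b + a * u.
have mphi : measurable_fun setT phi.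
  by apply: measurable_funD => //; exact: measurable_funM.
have H := @eq_measure_integral _ (measurableTypeR R) R D
  (mscale (NngNum (ltW a0)) (pushforward mu phi)).
rewrite (H mphi).
  rewrite ge0_integral_mscale; [|exact: mD|exact: mf|by move=> x _; exact: f0].
  by rewrite (ge0_integral_pushforward mphi).
by move=> A mA _; exact: lebesgue_affine.
Qed.

Lemma Rint_affine (a b : R) D f : 0 < a -> measurable D -> measurable_fun D f ->
  Rintegrable ((fun u => b + a * u) @^-1` D) (fun u => f (b + a * u)) ->
  Rintegrable D f /\ Rint D f = a * Rint ((fun u => b + a * u) @^-1` D) (fun u => f (b + a * u)).
Proof.
move=> a0 mD mf hi.
have i1 : Rintegrable D f.
  apply/integrableP; split; first exact/meas_EFin.
  rewrite (ge0_integral_affine b a0)//.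
    rewrite lte_mul_pinfty//; first by rewrite lee_fin ltW.
    by case/integrableP: hi.
  by apply: measurableT_comp => //; exact/meas_EFin.
split => //; rewrite /Rint /Rintegral integralE [in RHS]integralE.
have hp := integrable_pos_fin_num _ hi; have hn := integrable_neg_fin_num _ hi.
rewrite (ge0_integral_affine b a0 mD _ (funepos_ge0 _)); last exact/measurable_funepos/meas_EFin.
rewrite (ge0_integral_affine b a0 mD _ (funeneg_ge0 _)); last exact/measurable_funeneg/meas_EFin.
have mp : measurable ((fun u => b + a * u) @^-1` D).
  have mphi : measurable_fun setT (fun u : measurableTypeR R => b + a * u : measurableTypeR R).
    by apply: measurable_funD => //; exact: measurable_funM.
  by rewrite -[X in measurable X]setTI; exact: mphi.
move: (hp mp) (hn mp) => {}hp {}hn.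
have aux (p q : \bar R) : p \is a fin_num -> q \is a fin_num ->
    fine (a%:E * p - a%:E * q)%E = a * fine (p - q)%E.
  by move: p q => [p| |] [q| |] //= _ _; rewrite mulrBr.
by move: hp hn; rewrite !unlock; exact: aux.
Qed.

(** The improper integrals over [0 < u < 1] and [0 < v] are reached along closed
    segments, each point belonging to all but finitely many of them. *)
Definition exhausts D (al bt : nat -> R) : Prop :=
  [/\ forall n, al n < bt n, forall n x, al n <= x <= bt n -> D x &
      forall x, D x -> \forall n \near \oo, al n <= x <= bt n].

Lemma Rintegral_exhaust D (al bt : nat -> R) (F f : R -> R) : measurable D ->
  exhausts D al bt ->
  (forall x, D x -> is_derive x 1 F (f x)) ->
  (forall x, D x -> {for x, continuous f}) ->
  forall n, (\int[mu]_(x in D) ((f \_ `[al n, bt n]) x)%:E =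
    (F (bt n) - F (al n))%:E)%E.
Proof.
move=> mD [hlt hD _] hF hf n.
have sD : `[al n, bt n] `<=` D by move=> x /=; rewrite in_itv; exact: hD.
have -> : (\int[mu]_(x in D) ((f \_ `[al n, bt n]) x)%:E =
    \int[mu]_(x in D) ((fun x => (f x)%:E) \_ `[al n, bt n]) x)%E.
  by apply: eq_integral => x _; rewrite !patchE; case: ifP.
rewrite -integral_mkcondr setIidr//.
rewrite (@continuous_FTC2 _ f F)//.
- apply: continuous_in_subspaceT => x; rewrite inE => /sD; exact: hf.
- have cF x : D x -> {for x, continuous F}.
    by move=> /hF [d _]; exact/differentiable_continuous/derivable1_diffP.
  split.
  + move=> x xab; have [] // : is_derive x 1 F (f x).
    by apply/hF/sD => /=; exact: subset_itv_oo_cc.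
  + by apply: cvg_at_right_filter; apply/cF/sD; rewrite /= in_itv /= lexx ltW.
  + by apply: cvg_at_left_filter; apply/cF/sD; rewrite /= in_itv /= lexx ltW.
- move=> x xab; rewrite derive1E; have [] // : is_derive x 1 F (f x).
  by apply/hF/sD => /=; exact: subset_itv_oo_cc.
Qed.

Lemma restrict_cvg D (al bt : nat -> R) (f : R -> R) x :
  (\forall n \near \oo, al n <= x <= bt n) ->
  (f \_ `[al n, bt n]) x @[n --> \oo] --> f x.
Proof.
move=> h; apply: cvg_near_cst; apply: filterS h => n h.
by rewrite patchE mem_set//= in_itv.
Qed.

(** Fundamental theorem on a set exhausted by segments, so that only the limits
    of the primitive along the exhaustion matter.  *)
Lemma Rint_FTC D (al bt : nat -> R) (F f : R -> R) (l : R) : measurable D ->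
  exhausts D al bt ->
  (forall x, D x -> is_derive x 1 F (f x)) ->
  (forall x, D x -> {for x, continuous f}) ->
  Rintegrable D f -> F (bt n) - F (al n) @[n --> \oo] --> l -> Rint D f = l.
Proof.
move=> mD hex hF hf i1 hl.
have mf := Rintegrable_measurable i1.
have [|||| _ h] := @Rint_dct D (fun n => f \_ `[al n, bt n]) f (fun x => `|f x|) mD.
- move=> n; rewrite patch_indic; apply: measurable_funM => //.
- by move=> x Dx; apply: (restrict_cvg D); case: hex => _ _; exact.
- by have := integrable_abse i1; apply: eq_integrable.
- move=> n x Dx; rewrite patchE; case: ifP => // _; by rewrite normr0.
have -> : l = limn (fun n => F (bt n) - F (al n)) by rewrite (cvg_lim _ hl).
rewrite -(cvg_lim (@norm_hausdorff _ _) h); congr (limn _); apply/funext => n.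
by rewrite /Rint /Rintegral (Rintegral_exhaust mD hex hF hf).
Qed.

(** By the Fatou lemma: the integrals over the exhausting segments are increments
    of [F], hence bounded. *)
Lemma Rintegrable_derive D (al bt : nat -> R) (F f : R -> R) (K : R) : open D ->
  exhausts D al bt ->
  (forall x, D x -> is_derive x 1 F (f x)) ->
  (forall x, D x -> {for x, continuous f}) ->
  (forall x, D x -> 0 <= f x) ->
  (forall n, F (bt n) - F (al n) <= K) -> Rintegrable D f.
Proof.
move=> oD hex hF hf f0 hK.
have mD : measurable D by exact: open_measurable.
have mf : measurable_fun D f.
  by apply: open_continuous_measurable_fun => // x; rewrite inE; exact: hf.
apply/integrableP; split; first exact/meas_EFin.
apply: (@le_lt_trans _ _ K%:E); last exact: ltry.
pose g n x : \bar R := ((f \_ `[al n, bt n]) x)%:E.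
have mg n : measurable_fun D (g n).
  apply/meas_EFin; rewrite patch_indic; apply: measurable_funM => //.
have g0 n x : D x -> (0 <= g n x)%E.
  by move=> Dx; rewrite lee_fin patchE; case: ifP => // _; exact: f0.
have h := @fatou _ _ R mu D mD g mg g0.
have -> : (\int[mu]_(x in D) `|(f x)%:E| = \int[mu]_(x in D) limn_einf (g ^~ x))%E.
  apply: eq_integral => x; rewrite inE => Dx.
  have hc : (g ^~ x) @ \oo --> (f x)%:E.
    apply: cvg_EFin; first exact: nearW.
    by apply: (restrict_cvg D); case: hex => _ _; exact.
  rewrite is_cvg_limn_einfE; last by apply/cvg_ex; exists (f x)%:E.
  by rewrite (cvg_lim _ hc)//= ger0_norm ?f0.
apply: le_trans h _; rewrite limn_einf_lim; apply: lime_le.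
  exact: is_cvg_einfs.
apply: nearW => n; apply: (@le_trans _ _ (\int[mu]_(x in D) g n x)%E).
  by apply: ereal_inf_lbound; exists n => //=.
by rewrite (Rintegral_exhaust mD hex hF hf) lee_fin.
Qed.

End RealIntegrals.

(** * Integrals of matrix functions *)

Section MatrixIntegrals.
Context {R : realType} {n : nat}.
Local Notation C := R[i].
Local Notation M := 'M[C]_n.+1.
Local Notation idx := ('I_n.+1 * 'I_n.+1 * bool)%type.
Implicit Types (D : set R) (F G : R -> M) (X Y : M).

Definition mx_measurable F : Prop := forall c, measurable_fun setT (fun s => rcoord c (F s)).

Lemma mx_measurable_cst X : mx_measurable (fun=> X).
Proof. by move=> c; exact: measurable_cst. Qed.

Lemma mx_measurableD F G : mx_measurable F -> mx_measurable G -> mx_measurable (fun s => F s + G s).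
Proof.
by move=> hF hG c; under eq_fun do rewrite rcoordD; exact: measurable_funD.
Qed.

Lemma mx_measurableM F G : mx_measurable F -> mx_measurable G -> mx_measurable (fun s => F s * G s).
Proof.
move=> hF hG e; under eq_fun do rewrite rcoordM.
apply: measurable_sum => c; apply: measurable_sum => d.
by apply: measurable_funM; [exact: measurable_funM|exact: measurable_cst].
Qed.

Lemma mx_measurableZ (r : R -> R) F : measurable_fun setT r -> mx_measurable F ->
  mx_measurable (fun s => (r s)%:C *: F s).
Proof.
by move=> hr hF c; under eq_fun do rewrite rcoordZ; exact: measurable_funM.
Qed.

Lemma mx_measurable_mexp X (r : R -> R) : measurable_fun setT r ->
  mx_measurable (fun s => mexp X (r s)).
Proof.
move=> hr c; apply: (@measurableT_comp _ _ _ _ _ _ (fun s => rcoord c (mexp X s))) => //.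
by apply: continuous_measurable_fun => s; exact: (mx_der_continuous (mexp_der X s)).
Qed.

Lemma mx_measurable_sub F D c : mx_measurable F -> measurable D ->
  measurable_fun D (fun s => rcoord c (F s)).
Proof. by move=> hF mD; apply: measurable_funS (hF c). Qed.

Lemma mx_integrableP D F :
  mx_integrable D F <-> forall c, Rintegrable D (fun s => rcoord c (F s)).
Proof.
split=> [h [[i j] []]|h i j]; [by case: (h i j)|by case: (h i j)|].
by split; [exact: (h (i, j, false))|exact: (h (i, j, true))].
Qed.

Lemma rcoord_mx_integral D F c : rcoord c (mx_integral D F) = Rint D (fun s => rcoord c (F s)).
Proof. by case: c => [[i j] []]; rewrite /rcoord /mx_integral mxE. Qed.

Lemma mx_integral_eq D F G : (forall s, D s -> F s = G s) ->
  mx_integral D F = mx_integral D G.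
Proof.
move=> h; apply: rcoord_inj => c; rewrite !rcoord_mx_integral.
by apply: eq_Rintegral => s; rewrite inE => /h ->.
Qed.

Lemma mx_integrable_eq D F G : measurable D -> (forall s, D s -> F s = G s) ->
  mx_integrable D F -> mx_integrable D G.
Proof.
move=> mD h /mx_integrableP hF; apply/mx_integrableP => c.
by apply: eq_integrable (hF c) => // s; rewrite inE => /h ->.
Qed.

(** Every coordinate of [X * Z * Y] is a linear form in the coordinates of [Z], so
    constant matrices come out of the integral on both sides. *)
Lemma mx_integral_lin D F X Y : measurable D -> mx_integrable D F ->
  mx_integrable D (fun s => X * F s * Y) /\
  mx_integral D (fun s => X * F s * Y) = X * mx_integral D F * Y.
Proof.
move=> mD /mx_integrableP hF.
pose k c d : R := rcoord c (X * rbasis d * Y : M).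
have kE c Z : rcoord c (X * Z * Y) = \sum_d k c d * rcoord d Z.
  rewrite {1}(rcoord_rbasis Z) mulr_sumr mulr_suml rcoord_sum; apply: eq_bigr => d _.
  by rewrite -scalerAr -scalerAl rcoordZ mulrC.
have h c := @Rintegrable_lin R D _ (index_enum idx) (k c) (fun d s => rcoord d (F s)) mD hF.
split.
  apply/mx_integrableP => c; under eq_fun do rewrite kE; exact: (h c).1.
apply: rcoord_inj => c; rewrite kE rcoord_mx_integral; under eq_fun do rewrite kE.
by rewrite (h c).2; apply: eq_bigr => d _; rewrite rcoord_mx_integral.
Qed.

Lemma mx_integralD D F G : measurable D -> mx_integrable D F -> mx_integrable D G ->
  mx_integrable D (fun s => F s + G s) /\
  mx_integral D (fun s => F s + G s) = mx_integral D F + mx_integral D G.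
Proof.
move=> mD /mx_integrableP hF /mx_integrableP hG; split.
  apply/mx_integrableP => c; under eq_fun do rewrite rcoordD.
  by rewrite /Rintegrable; under eq_fun do rewrite EFinD; exact: integrableD (hF c) (hG c).
apply: rcoord_inj => c; rewrite rcoordD !rcoord_mx_integral; under eq_fun do rewrite rcoordD.
by rewrite /Rint RintegralD//; [exact: hF|exact: hG].
Qed.

Lemma mx_integral_sum D (I : Type) (r : seq I) (F_ : I -> R -> M) : measurable D ->
  (forall i, mx_integrable D (F_ i)) ->
  mx_integrable D (fun s => \sum_(i <- r) F_ i s) /\
  mx_integral D (fun s => \sum_(i <- r) F_ i s) = \sum_(i <- r) mx_integral D (F_ i).
Proof.
move=> mD h; elim: r => [|i r [IH1 IH2]].
  rewrite big_nil; under eq_fun do rewrite big_nil.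
  split.
    by apply/mx_integrableP => c; under eq_fun do rewrite rcoord0; exact: integrable0.
  apply: rcoord_inj => c; rewrite rcoord_mx_integral; under eq_fun do rewrite rcoord0.
  by rewrite /Rint Rintegral_cst// mul0r rcoord0.
have [h1 h2] := mx_integralD mD (h i) IH1.
by rewrite big_cons -IH2 -h2; under eq_fun do rewrite big_cons.
Qed.

Lemma mx_integrable_le D F (g : R -> R) : measurable D -> mx_measurable F ->
  (forall s, D s -> nrm (F s) <= g s) -> Rintegrable D g -> mx_integrable D F.
Proof.
move=> mD mF hg ig; apply/mx_integrableP => c.
apply: (Rintegrable_le mD _ _ ig); first exact: mx_measurable_sub.
move=> s /hg; exact/le_trans/le_rcoord_nrm.
Qed.

Lemma Rintegrable_nrm D F : measurable D -> mx_integrable D F -> Rintegrable D (fun s => nrm (F s)).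
Proof.
move=> mD /mx_integrableP hF; under eq_fun do rewrite nrmE.
have ha c : Rintegrable D (fun s => `|rcoord c (F s)|).
  by have := integrable_abse (hF c); apply: eq_integrable.
have [h _] := Rintegrable_lin (index_enum idx) (fun=> 1) mD ha.
by apply: eq_integrable h => // s _; congr EFin; apply: eq_bigr => c _; rewrite mul1r.
Qed.

Lemma mx_dct D (F_ : nat -> R -> M) F (g : R -> R) : measurable D ->
  (forall k, mx_measurable (F_ k)) -> (forall s, D s -> mx_cvg \oo (F_ ^~ s) (F s)) ->
  (forall k s, D s -> nrm (F_ k s) <= g s) -> Rintegrable D g ->
  mx_integrable D F /\ mx_cvg \oo (fun k => mx_integral D (F_ k)) (mx_integral D F).
Proof.
move=> mD mF hF hg ig.
have h c : Rintegrable D (fun s => rcoord c (F s)) /\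
    Rint D (fun s => rcoord c (F_ k s)) @[k --> \oo] --> Rint D (fun s => rcoord c (F s)).
  apply: (Rint_dct mD _ _ ig).
  - by move=> k; exact: mx_measurable_sub.
  - by move=> s Ds; exact: hF.
  - by move=> k s /hg h'; exact: le_trans (le_rcoord_nrm _ _) (h' k).
split; first by apply/mx_integrableP => c; exact: (h c).1.
by move=> c; rewrite rcoord_mx_integral; under eq_fun do rewrite rcoord_mx_integral;
  exact: (h c).2.
Qed.

Lemma mx_integral_FTC D (al bt : nat -> R) F (f : R -> M) X : measurable D ->
  exhausts D al bt -> (forall s, D s -> mx_der F s (f s)) ->
  (forall s, D s -> mx_cvg (nbhs s) f (f s)) -> mx_integrable D f ->
  mx_cvg \oo (fun k => F (bt k) - F (al k)) X -> mx_integral D f = X.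
Proof.
move=> mD hex hF hf /mx_integrableP hi hX; apply: rcoord_inj => c.
rewrite rcoord_mx_integral.
apply: (Rint_FTC (F := fun s => rcoord c (F s)) mD hex).
- by move=> s Ds; exact: hF.
- by move=> s Ds; exact: hf.
- exact: hi.
- by have := hX c; under [in X in X -> _]eq_fun do rewrite rcoordB.
Qed.

Lemma mx_integral_affine (a b : R) D F : 0 < a -> measurable D -> mx_measurable F ->
  mx_integrable ((fun u => b + a * u) @^-1` D) (fun u => F (b + a * u)) ->
  mx_integrable D F /\ mx_integral D F =
    a%:C *: mx_integral ((fun u => b + a * u) @^-1` D) (fun u => F (b + a * u)).
Proof.
move=> a0 mD mF /mx_integrableP hi.
have h c := Rint_affine a0 mD (mx_measurable_sub c mF mD) (hi c).
split; first by apply/mx_integrableP => c; exact: (h c).1.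
by apply: rcoord_inj => c; rewrite rcoordZ !rcoord_mx_integral (h c).2.
Qed.

End MatrixIntegrals.

(** * Powers and exponential decay *)

Section Powers.
Context {R : realType} {n : nat}.
Local Notation C := R[i].
Local Notation M := 'M[C]_n.+1.
Implicit Types (X Y P Q : M) (s t u : R).

(** The quantitative form in which positive stability is used. *)
Definition decays X : Prop := exists a, 0 < a /\ exists2 K, 0 <= K &
  forall s, 0 <= s -> nrm (mexp X (- s)) <= K * expR (- (a * s)).

Lemma decaysD X Y : GRing.comm X Y -> decays X -> decays Y -> decays (X + Y).
Proof.
move=> cXY [a [a0 [K K0 hK]]] [b [b0 [L L0 hL]]].
exists (a + b); split; first exact: addr_gt0.
exists (K * L) => [|s s0]; first exact: mulr_ge0.
rewrite mexp_add// (le_trans (nrmM _ _))// mulrDl opprD expRD mulrACA.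
by apply: ler_pM => //; [exact: hK|exact: hL].
Qed.

Lemma decays_addr X (r : R) : 0 <= r -> decays X -> decays (X + r%:C%:M).
Proof.
move=> r0 [a [a0 [K K0 hK]]]; exists a; split => //; exists K => // s s0.
rewrite mexp_add; last exact/commr_sym/comm_scalar.
rewrite mexp_real -scalemx1 -scalerAr mulr1 nrmZ ger0_norm ?expR_ge0//.
rewrite -[leRHS]mul1r; apply: ler_pM => //; [|exact: hK].
by rewrite -expR0 ler_expR mulrN oppr_le0 mulr_ge0.
Qed.

Lemma decays_add1 X : decays X -> decays (X + 1).
Proof. by move=> dX; have := decays_addr ler01 dX; rewrite rmorph1. Qed.

(** The rows of [kermx X] are fixed by every [mexp X s]; as [mexp X (- s)] tends to
    [0], the kernel vanishes. *)
Lemma decays_unit X : decays X -> X \is a GRing.unit.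
Proof.
move=> [a [a0 [K K0 hK]]]; set V := kermx X.
have VX : V * X = 0 by exact: mulmx_ker.
have VE s : V * mexp X s = V.
  rewrite (@mx_der0_cst R n (fun s => V * mexp X s) _ s 0) ?mexp0 ?mulr1// => r.
  apply: mx_der_eq; first exact: (mx_derM (mx_der_cst V r) (mexp_der X r)).
  by rewrite mul0r add0r mulrA VX mul0r.
have hs s : 0 <= s -> nrm V <= nrm V * K * expR (- (a * s)).
  move=> s0; rewrite -{1}(VE (- s)) -mulrA (le_trans (nrmM _ _))//.
  by rewrite ler_wpM2l// hK.
suff V0 : V = 0 by rewrite -row_free_unit -kermx_eq0 -/V V0.
apply: nrm_eq0; apply/eqP; rewrite eq_le nrm_ge0 andbT leNgt; apply/negP => V0.
have NK0 : 0 < nrm V * K.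
  by rewrite lt0r mulr_ge0// andbT; apply/eqP => e; have := hs 0 (lexx _); rewrite e mul0r leNgt V0.
pose s := 2 * K / a.
have s0 : 0 <= s by rewrite !mulr_ge0// invr_ge0 ltW.
have := hs s s0; rewrite -mulrA -[leLHS]mulr1 ler_pM2l// expRN.
have -> : a * s = 2 * K by rewrite /s; field; lra.
rewrite ler_pdivlMr ?expR_gt0// mul1r leNgt => /negP; apply.
by have := expR_ge1Dx (2 * K); lra.
Qed.

Lemma decays1 : decays 1.
Proof.
exists 1; split => //; exists (nrm (1 : M)) => // s _.
have -> : 1 = (1 : R)%:C%:M :> M by rewrite rmorph1.
rewrite mexp_real -scalemx1 nrmZ ger0_norm ?expR_ge0//.
by rewrite mulrC mul1r mulrN mul1r rmorph1.
Qed.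

Lemma mexp0l s : mexp (0 : M) s = 1.
Proof.
have e : (0 : R)%:C%:M = 0 :> M by rewrite -scalemx1 scale0r.
by rewrite -e mexp_real mul0r expR0.
Qed.

Definition mxpow X t : M := mexp X (ln t).

Lemma mxpow_rpow X t : mx_rpow t X = mxpow X t.
Proof. by rewrite /mxpow mexpE. Qed.

Lemma mxpow1 X : mxpow X 1 = 1. Proof. by rewrite /mxpow ln1 mexp0. Qed.

Lemma mxpowM X t u : 0 < t -> 0 < u -> mxpow X (t * u) = mxpow X t * mxpow X u.
Proof. by move=> t0 u0; rewrite /mxpow lnM ?posrE// mexpD. Qed.

Lemma mxpow_add X Y t : GRing.comm X Y -> mxpow (X + Y) t = mxpow X t * mxpow Y t.
Proof. exact: mexp_add. Qed.

Lemma mxpow_comm X Y t : GRing.comm Y X -> GRing.comm Y (mxpow X t).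
Proof. exact: mexp_comm. Qed.

Lemma mxpow_addr X (r : R) t : mxpow (X + r%:C%:M) t = (expR (r * ln t))%:C *: mxpow X t.
Proof.
rewrite mxpow_add; last exact/commr_sym/comm_scalar.
by rewrite /mxpow mexp_real -scalemx1 -scalerAr mulr1.
Qed.

Lemma mxpow_sub1 X t : 0 < t -> mxpow (X - 1) t = (t^-1)%:C *: mxpow X t.
Proof.
move=> t0; have -> : X - 1 = X + (-1)%:C%:M by rewrite rmorphN1 raddfN.
by rewrite mxpow_addr mulN1r expRN lnK ?posrE.
Qed.

Lemma mxpow_add1 X t : 0 < t -> mxpow (X + 1) t = t%:C *: mxpow X t.
Proof.
by move=> t0; have := mxpow_addr X 1 t; rewrite rmorph1 mul1r lnK ?posrE.
Qed.

Lemma mxpow_addn X (k : nat) t : 0 < t -> mxpow (X + (k%:R)%:M) t = (t ^+ k)%:C *: mxpow X t.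
Proof.
move=> t0; have := mxpow_addr X k%:R t.
by rewrite rmorph_nat mulr_natl -lnXn// lnK ?posrE// exprn_gt0.
Qed.

Lemma mxpow_der X t : 0 < t -> mx_der (mxpow X) t ((t^-1)%:C *: (X * mxpow X t)).
Proof. by move=> t0; exact: (mx_der_comp (mexp_der X (ln t)) (is_derive1_ln t0)). Qed.

Lemma mx_measurable_mxpow X (r : R -> R) : measurable_fun setT r ->
  mx_measurable (fun s => mxpow X (r s)).
Proof.
by move=> mr; apply: mx_measurable_mexp; apply: measurableT_comp => //; exact: measurable_ln.
Qed.

Lemma mxpow_decay X : decays X -> exists a, 0 < a /\ exists2 K, 0 <= K &
  forall u, 0 < u <= 1 -> nrm (mxpow X u) <= K * expR (a * ln u).
Proof.
move=> [a [a0 [K K0 hK]]]; exists a; split => //; exists K => // u /andP[u0 u1].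
have := hK (- ln u); rewrite opprK mulrN opprK; apply.
by rewrite oppr_ge0 ln_le0.
Qed.

Definition bounded01 X : Prop := exists2 K, 0 <= K &
  forall u, 0 < u <= 1 -> nrm (mxpow X u) <= K.

Lemma decays_bounded01 X : decays X -> bounded01 X.
Proof.
move=> /mxpow_decay[a [a0 [K K0 hK]]]; exists K => // u u01.
apply: le_trans (hK _ u01) _; rewrite -[leRHS]mulr1 ler_wpM2l// -expR0 ler_expR.
by case/andP: u01 => u0 u1; rewrite pmulr_rle0 ?ln_le0.
Qed.

Lemma bounded01_0 : bounded01 0.
Proof.
by exists (nrm (1 : M)) => // u _; rewrite /mxpow mexp0l.
Qed.

Lemma mxpow_cvg0 X (r : nat -> R) : decays X -> (forall k, 0 < r k <= 1) ->
  r k @[k --> \oo] --> 0 -> mx_cvg \oo (fun k => mxpow X (r k)) 0.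
Proof.
move=> /mxpow_decay[a [a0 [K K0 hK]]] hr h0.
apply: (mx_cvg_le (r := fun k => K * expR (a * ln (r k)))).
  by move=> k; rewrite subr0 hK.
rewrite -(mulr0 K); apply: cvgMr.
apply/cvgrPdist_lt => e e0; have d0 := expR_gt0 (ln e / a).
move/cvgrPdist_lt : h0 => /(_ _ d0); apply: filterS => k.
rewrite !sub0r !normrN; have /andP[rk0 _] := hr k.
rewrite !gtr0_norm ?expR_gt0// => hk.
rewrite -(lnK (x := e)) ?posrE// ltr_expR mulrC -ltr_pdivlMr//.
by rewrite -ltr_expR lnK ?posrE.
Qed.

Lemma mxpow_cvg1 X (r : nat -> R) : r k @[k --> \oo] --> (1 : R) ->
  mx_cvg \oo (fun k => mxpow X (r k)) 1.
Proof.
move=> h c; rewrite -(mxpow1 X).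
have h' : mx_cvg (nbhs (1 : R)) (mxpow X) (mxpow X 1) := mx_der_continuous (mxpow_der X ltr01).
exact: cvg_comp h (h' c).
Qed.

(** The usual perturbation argument, in finite dimension: a kernel vector [V]
    satisfies [V = V * (1 - X)]. *)
Lemma nrm_unit X : nrm (1 - X) < 1 -> X \is a GRing.unit.
Proof.
move=> h; set V := kermx X.
have VX : V * X = 0 by exact: mulmx_ker.
suff V0 : V = 0 by rewrite -row_free_unit -kermx_eq0 -/V V0.
apply: nrm_eq0; apply/eqP; rewrite eq_le nrm_ge0 andbT leNgt; apply/negP => V0.
have := nrmM V (1 - X); rewrite mulrBr mulr1 VX subr0 leNgt => /negP; apply.
by rewrite -[ltRHS]mulr1 ltr_pM2l.
Qed.

End Powers.

(** * Integrable majorants *)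

Section Majorants.
Context {R : realType}.
Implicit Types (a u v x : R).

Lemma near_inv_le x j : 0 < x -> \forall k \near \oo, ((k + j).+1%:R : R)^-1 <= x.
Proof.
move=> x0; have := nbhs_infty_ger x^-1; apply: filterS => k hk.
rewrite invf_ple ?posrE//; apply: le_trans hk _.
by rewrite ler_nat -addSn (leq_trans (leqnSn _))// leq_addr.
Qed.

Lemma exhausts01 : exhausts (`]0, 1[ : set R)
  (fun k => ((k + 2).+1%:R : R)^-1) (fun k => 1 - ((k + 2).+1%:R : R)^-1).
Proof.
have h3 k : 0 < ((k + 2).+1%:R : R)^-1 <= 3^-1.
  by rewrite invr_gt0 ltr0n /= lef_pV2 ?posrE// ler_nat addn2.
split.
- by move=> k; move: (h3 k); move: (((k + 2).+1%:R : R)^-1) => r /andP[? ?]; lra.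
- move=> k x; rewrite /= in_itv /=; move: (h3 k).
  by move: (((k + 2).+1%:R : R)^-1) => r /andP[? ?] /andP[? ?]; apply/andP; split; lra.
- move=> x; rewrite /= in_itv /= => /andP[x0 x1].
  have x1' : 0 < 1 - x by rewrite subr_gt0.
  have := near_inv_le 2 x1'; have := near_inv_le 2 x0; apply: filterS2 => k.
  by move: (((k + 2).+1%:R : R)^-1) => r ? ?; apply/andP; split; lra.
Qed.

Lemma exhausts0y : exhausts (`]0, +oo[ : set R)
  (fun k => ((k + 1).+1%:R : R)^-1) (fun k => (k + 1).+1%:R).
Proof.
have h3 k : 0 < ((k + 1).+1%:R : R)^-1 <= 2^-1.
  by rewrite invr_gt0 ltr0n /= lef_pV2 ?posrE// ler_nat addn1.
have h2 k : 2 <= ((k + 1).+1%:R : R) by rewrite ler_nat addn1.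
split.
- move=> k; have := h2 k; move: (h3 k); move: (((k + 1).+1%:R : R)^-1) => r /andP[? ?].
  by move: ((k + 1).+1%:R : R) => w; lra.
- move=> k x; rewrite /= in_itv /= andbT; move: (h3 k).
  by move: (((k + 1).+1%:R : R)^-1) => r /andP[? ?] /andP[? _]; lra.
- move=> x; rewrite /= in_itv /= andbT => x0.
  have := near_inv_le 1 x0; have := nbhs_infty_ger x; apply: filterS2 => k h h'.
  rewrite h' (le_trans h)// ler_nat addn1; exact: leq_trans (leqnSn _) (leqnSn _).
Qed.

Lemma cvg_invS j : ((k + j).+1%:R : R)^-1 @[k --> \oo] --> 0.
Proof.
apply/cvgrPdist_le => e e0; have := near_inv_le j e0; apply: filterS => k.
by rewrite sub0r normrN ger0_norm.
Qed.

Lemma is_derive_expRln (a u : R) : 0 < u ->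
  is_derive u 1 (fun u => expR (a * ln u)) (a * expR ((a - 1) * ln u)).
Proof.
move=> u0.
have h : is_derive u 1 (fun u => a * ln u) (a * u^-1).
  by have := is_deriveZ a (is_derive1_ln u0).
have := @is_derive1_comp _ expR (fun u => a * ln u) _ _ _ (is_derive_expR _) h => h1.
by apply: is_derive_eq h1 _; rewrite mulrBl expRD mul1r expRN lnK ?posrE//; ring.
Qed.

(** [u ^ (a - 1)] is the derivative of the bounded function [u ^ a / a]. *)
Lemma Rintegrable_pow01 a : 0 < a -> Rintegrable `]0, 1[ (fun u => expR ((a - 1) * ln u)).
Proof.
move=> a0.
apply: (Rintegrable_derive (F := fun u => a^-1 * expR (a * ln u)) (K := a^-1)) (exhausts01) _ _ _ _.
- exact: interval_open.
- move=> u; rewrite /= in_itv /= => /andP[u0 _].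
  have := is_deriveZ a^-1 (is_derive_expRln a u0) => h; apply: is_derive_eq h _.
  by rewrite /GRing.scale /=; field; lra.
- move=> u; rewrite /= in_itv /= => /andP[u0 _].
  exact: is_derive1_continuous (is_derive_expRln (a - 1) u0).
- by move=> u _; exact: expR_ge0.
- move=> k; set r := ((k + 2).+1%:R : R)^-1; have r0 : 0 < r < 1.
    by rewrite /r invr_gt0 ltr0n /= invf_lt1 ?ltr0n// ltr1n addn2.
  case/andP: r0 => r0 r1.
  rewrite -mulrBr -[leRHS]mulr1 ler_wpM2l ?invr_ge0 ?(ltW a0)//.
  have h1 : expR (a * ln (1 - r)) <= 1.
    by rewrite expR_le1 pmulr_rle0// ln_le0//; lra.
  by have := expR_ge0 (a * ln r); lra.
Qed.

Lemma Rintegrable_pow10 a : 0 < a -> Rintegrable `]0, 1[ (fun u => expR ((a - 1) * ln (1 - u))).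
Proof.
move=> a0.
have h1 (u : R) : is_derive u 1 (fun u => 1 - u) (-1).
  by have := is_deriveB (is_derive_cst (1 : R) u 1) (is_derive_id u 1); rewrite sub0r.
apply: (Rintegrable_derive (F := fun u => - a^-1 * expR (a * ln (1 - u)))
  (K := a^-1)) (exhausts01) _ _ _ _.
- exact: interval_open.
- move=> u; rewrite /= in_itv /= => /andP[_ u1].
  have u1' : 0 < 1 - u by rewrite subr_gt0.
  have := @is_derive1_comp _ (fun u => expR (a * ln u)) (fun u => 1 - u) _ _ _
    (is_derive_expRln a u1') (h1 u).
  move=> /(is_deriveZ (- a^-1)) h; apply: is_derive_eq h _.
  by rewrite /GRing.scale /=; field; lra.
- move=> u; rewrite /= in_itv /= => /andP[_ u1].
  have u1' : 0 < 1 - u by rewrite subr_gt0.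
  have := @is_derive1_comp _ (fun u => expR ((a - 1) * ln u)) (fun u => 1 - u) _ _ _
    (is_derive_expRln (a - 1) u1') (h1 u).
  exact: is_derive1_continuous.
- by move=> u _; exact: expR_ge0.
- move=> k; set r := ((k + 2).+1%:R : R)^-1; have r0 : 0 < r < 1.
    by rewrite /r invr_gt0 ltr0n /= invf_lt1 ?ltr0n// ltr1n addn2.
  case/andP: r0 => r0 r1.
  rewrite -mulrBr mulNr -mulrN opprB -[leRHS]mulr1 ler_wpM2l ?invr_ge0 ?(ltW a0)//.
  have h2 : expR (a * ln (1 - r)) <= 1.
    by rewrite expR_le1 pmulr_rle0// ln_le0//; lra.
  by have := expR_ge0 (a * ln (1 - (1 - r))); lra.
Qed.

(** [v ^ (a - 1) / (1 + v) ^ (a + 1)] behaves like [v ^ (a - 1)] at [0] and like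
    [v ^ -2] at infinity, and has an elementary primitive. *)
Definition gamma_majorant a v : R :=
  expR ((a - 1) * ln v - (a + 1) * ln (1 + v)).

(** It is the derivative of the bounded function [(v / (1 + v)) ^ a / a]. *)
Lemma Rintegrable_gamma_majorant a : 0 < a -> Rintegrable `]0, +oo[ (gamma_majorant a).
Proof.
move=> a0.
have h1 (v : R) : is_derive v 1 (fun v => 1 + v) 1.
  by have := is_deriveD (is_derive_cst (1 : R) v 1) (is_derive_id v 1); rewrite add0r.
have hl (b c v : R) : 0 < v ->
    is_derive v 1 (fun v => expR (b * ln v - c * ln (1 + v)))
      (expR (b * ln v - c * ln (1 + v)) * (b * v^-1 - c * (1 + v)^-1)).
  move=> v0; apply: (@is_derive1_comp _ expR).
  have v1 : 0 < 1 + v by lra.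
  have := @is_derive1_comp _ (@ln R) (fun v => 1 + v) _ _ _ (is_derive1_ln v1) (h1 v).
  rewrite mulr1 => /(is_deriveZ c) h2.
  exact: (is_deriveB (is_deriveZ b (is_derive1_ln v0)) h2).
apply: (Rintegrable_derive (F := fun v => a^-1 * expR (a * ln v - a * ln (1 + v)))
  (K := a^-1)) (exhausts0y) _ _ _ _.
- exact: interval_open.
- move=> v; rewrite /= in_itv /= andbT => v0; have v1 : 0 < 1 + v by lra.
  have := is_deriveZ a^-1 (hl a a v v0) => h; apply: is_derive_eq h _.
  rewrite /gamma_majorant /GRing.scale /= mulrBl mulrDl !mul1r.
  have -> : a * ln v - ln v - (a * ln (1 + v) + ln (1 + v)) =
    (a * ln v - a * ln (1 + v)) - ln v - ln (1 + v) by ring.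
  by rewrite !expRB !lnK ?posrE//; field; rewrite expR_eq0 !gt_eqF.
- move=> v; rewrite /= in_itv /= andbT => v0.
  exact: is_derive1_continuous (hl _ _ _ v0).
- by move=> u _; exact: expR_ge0.
- move=> k; set r := ((k + 1).+1%:R : R); have r0 : 0 < r by rewrite ltr0n.
  rewrite -mulrBr -[leRHS]mulr1 ler_wpM2l ?invr_ge0 ?(ltW a0)//.
  have h2 : expR (a * ln r - a * ln (1 + r)) <= 1.
    rewrite expR_le1 -mulrBr pmulr_rle0// subr_le0 ler_ln ?posrE//; lra.
  by have := expR_ge0 (a * ln r^-1 - a * ln (1 + r^-1)); lra.
Qed.

(** [ln] lies below its tangent at [k]. *)
Lemma ln_bound (k v : R) : 0 < k -> 0 < v -> k * ln v <= v + k * ln k.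
Proof.
move=> k0 v0; have := le_ln1Dx (x := v / k - 1).
have vk : 0 < v / k by exact: divr_gt0.
rewrite addrCA subrr addr0 ln_div ?posrE// => /(_ _) h.
have {}h : ln v - ln k <= v / k - 1 by apply: h; lra.
have : k * (ln v - ln k) <= k * (v / k - 1) by rewrite ler_wpM2l// ltW.
have -> : k * (v / k - 1) = v - k by field; lra.
by rewrite mulrBr; lra.
Qed.

(** The left-hand side is the shape of the bound on [e ^ (- v) v ^ (X - 1)]: near [0]
    decay with rate [a], far away at most polynomial growth of degree [m]. *)
Lemma gamma_majorant_ge (a m : R) : 0 < a -> 0 <= m -> exists2 K : R, 0 <= K &
  forall v : R, 0 < v ->
  (if v <= 1 then expR (a * ln v) else expR (m * ln v)) * expR (- v) * v^-1
    <= K * gamma_majorant a v.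
Proof.
move=> a0 m0.
exists (expR ((a + 1) * ln 2 + (m + 1) * ln (m + 1))); first exact: expR_ge0.
have m1 : 0 <= (m + 1) * ln (m + 1).
  by rewrite mulr_ge0 ?addr_ge0// ln_ge0// lerDr.
have l2 : 0 <= ln (2 : R) by rewrite ln_ge0 ?ler1n.
move=> v v0; rewrite /gamma_majorant -expRD.
have -> : v^-1 = expR (- ln v) by rewrite expRN lnK ?posrE.
case: ifPn => v1; rewrite -!expRD ler_expR.
  have : ln (1 + v) <= ln 2 by rewrite ler_ln ?posrE//; lra.
  nra.
rewrite -ltNge in v1.
have : ln (1 + v) <= ln 2 + ln v.
  by rewrite -lnM ?posrE// ler_ln ?posrE//; lra.
have m2 : 0 < m + 1 by lra.
have := ln_bound m2 v0.
nra.
Qed.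

End Majorants.

(** * The Beta integral *)

Section Beta.
Context {R : realType} {n : nat}.
Local Notation C := R[i].
Local Notation M := 'M[C]_n.+1.
Implicit Types (X Y P Q S : M) (s t u v : R).

Definition beta_kernel P Q u : M := mxpow (P - 1) (1 - u) * mxpow (Q - 1) u.

Fact Beta_key : unit. Proof. exact: tt. Qed.

Definition Beta : M -> M -> M :=
  locked_with Beta_key (fun P Q => mx_integral `]0, 1[ (beta_kernel P Q)).

Lemma BetaE P Q : Beta P Q = mx_integral `]0, 1[ (beta_kernel P Q).
Proof. by rewrite /Beta locked_withE. Qed.

Lemma mx_measurable_beta_kernel P Q : mx_measurable (beta_kernel P Q).
Proof.
apply: mx_measurableM; apply: mx_measurable_mxpow => //.
by apply: measurable_funB.
Qed.

Lemma beta_kernelE P Q u : 0 < u < 1 ->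
  beta_kernel P Q u = ((1 - u)^-1 * u^-1)%:C *: (mxpow P (1 - u) * mxpow Q u).
Proof.
move=> /andP[u0 u1]; rewrite /beta_kernel !mxpow_sub1 ?subr_gt0//.
by rewrite -scalerAl -scalerAr scalerA rmorphM.
Qed.

(** [1 / (u (1 - u)) = 1 / u + 1 / (1 - u)] separates the two singularities. *)
Lemma beta_kernel_integrable P Q : decays P -> decays Q -> mx_integrable `]0, 1[ (beta_kernel P Q).
Proof.
move=> /mxpow_decay[a [a0 [K K0 hK]]] /mxpow_decay[b [b0 [L L0 hL]]].
apply: (mx_integrable_le (g := fun u => (K * L) *
   (expR ((a - 1) * ln (1 - u)) + expR ((b - 1) * ln u)))) => //.
- exact: mx_measurable_beta_kernel.
- move=> u; rewrite /= in_itv /= => /andP[u0 u1].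
  have v0 : 0 < 1 - u by rewrite subr_gt0.
  rewrite beta_kernelE ?u0// nrmZ ger0_norm; last by rewrite mulr_ge0 ?invr_ge0 ?ltW.
  have -> : (1 - u)^-1 / u = (1 - u)^-1 + u^-1 by field; rewrite !gt_eqF.
  have h : nrm (mxpow P (1 - u) * mxpow Q u) <=
      K * L * (expR (a * ln (1 - u)) * expR (b * ln u)).
    rewrite (le_trans (nrmM _ _))// mulrACA; apply: ler_pM => //.
      by apply: hK; lra.
    by apply: hL; lra.
  have hi : 0 <= (1 - u)^-1 + u^-1 by rewrite addr_ge0 ?invr_ge0 ?ltW.
  apply: (le_trans (ler_wpM2l hi h)).
  rewrite mulrCA ler_wpM2l ?mulr_ge0// !mulrBl !expRD !mul1r !expRN !lnK ?posrE//.
  have e1 : expR (a * ln (1 - u)) <= 1.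
    by rewrite expR_le1 pmulr_rle0// ln_le0; lra.
  have e2 : expR (b * ln u) <= 1 by rewrite expR_le1 pmulr_rle0// ln_le0// ltW.
  have p1 := expR_ge0 (a * ln (1 - u)); have p2 := expR_ge0 (b * ln u).
  rewrite mulrDl; apply: lerD.
    rewrite mulrC ler_wpM2r ?invr_ge0 ?(ltW v0)//.
    by rewrite -[leRHS]mulr1 ler_wpM2l.
  rewrite mulrC ler_wpM2r ?invr_ge0 ?(ltW u0)//.
  by rewrite -[leRHS]mul1r ler_wpM2r.
- have h1 := Rintegrable_pow10 a0; have h2 := Rintegrable_pow01 b0.
  have hc c : Rintegrable `]0, 1[
      (fun u => if c then expR ((a - 1) * ln (1 - u)) else expR ((b - 1) * ln u)).
    by case: c.
  have [h _] := Rintegrable_lin [:: true; false] (fun=> K * L) (measurable_itv `]0, 1[) hc.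
  apply: eq_integrable h => // u _; congr EFin.
  by rewrite !big_cons big_nil addr0 mulrDr.
Qed.

Lemma mxpow_onem_der X u : u < 1 ->
  mx_der (fun u => mxpow X (1 - u)) u (- ((1 - u)^-1)%:C *: (X * mxpow X (1 - u))).
Proof.
move=> u1; have v0 : 0 < 1 - u by rewrite subr_gt0.
have h1 : is_derive u 1 (fun u : R => 1 - u) (-1).
  by have := is_deriveB (is_derive_cst (1 : R) u 1) (is_derive_id u 1); rewrite sub0r.
have h := mx_der_comp (g := fun u : R => 1 - u) (mxpow_der X v0) h1; apply: mx_der_eq h _.
by rewrite scalerA rmorphN1 mulN1r.
Qed.

Lemma beta_kernel_continuous P Q u : 0 < u < 1 ->
  mx_cvg (nbhs u) (beta_kernel P Q) (beta_kernel P Q u).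
Proof.
move=> /andP[u0 u1]; apply: mx_cvgM.
  exact: (mx_der_continuous (mxpow_onem_der (P - 1) u1)).
exact: (mx_der_continuous (mxpow_der (Q - 1) u0)).
Qed.

Lemma cvg_onem (r : nat -> R) l : r k @[k --> \oo] --> l -> 1 - r k @[k --> \oo] --> 1 - l.
Proof. by move=> h; apply: cvgB => //; exact: cvg_cst. Qed.

Lemma in01_invS k : 0 < ((k + 2).+1%:R : R)^-1 <= 1.
Proof. by rewrite invr_gt0 ltr0n /= invf_le1 ?ltr0n// ler1n. Qed.

(** The base case: [u ^ Q] has derivative [Q u ^ (Q - 1)]. *)
Lemma Beta1 Q : decays Q -> Q * Beta 1 Q = 1.
Proof.
move=> dQ.
have [h1 h2] := mx_integral_lin Q 1 (measurable_itv `]0, 1[) (beta_kernel_integrable decays1 dQ).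
rewrite mulr1 -BetaE in h2; rewrite -h2.
apply: (mx_integral_FTC (F := mxpow Q) (measurable_itv `]0, 1[) exhausts01 _ _ h1).
- move=> u; rewrite /= in_itv /= => /andP[u0 u1].
  apply: mx_der_eq (mxpow_der Q u0) _; rewrite mulr1 /beta_kernel subrr.
  rewrite /mxpow mexp0l mul1r -!/(mxpow _ _).
  by rewrite mxpow_sub1// -scalerAr.
- move=> u; rewrite /= in_itv /= => u01.
  apply: mx_cvgM; last exact: mx_cvg_cst.
  by apply: mx_cvgM; [exact: mx_cvg_cst|exact: beta_kernel_continuous].
- rewrite -[X in mx_cvg _ _ X]subr0; apply: mx_cvgB.
    by apply: mxpow_cvg1; have := cvg_onem (cvg_invS 2); rewrite subr0.
  apply: mxpow_cvg0 => //; first exact: in01_invS.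
  exact: cvg_invS.
Qed.

Lemma beta_kernel_add1l P Q u : u < 1 -> beta_kernel (P + 1) Q u = (1 - u)%:C *: beta_kernel P Q u.
Proof.
move=> u1; rewrite /beta_kernel (addrAC _ 1) mxpow_add1 ?subr_gt0//.
by rewrite -scalerAl.
Qed.

Lemma beta_kernel_add1r P Q u : 0 < u -> beta_kernel P (Q + 1) u = u%:C *: beta_kernel P Q u.
Proof.
by move=> u0; rewrite /beta_kernel (addrAC _ 1) mxpow_add1// -scalerAr.
Qed.

(** From [(1 - u) + u = 1]. *)
Lemma Beta_split P Q : decays P -> decays Q ->
  decays (P + 1) -> decays (Q + 1) -> Beta P Q = Beta (P + 1) Q + Beta P (Q + 1).
Proof.
move=> dP dQ dP1 dQ1.
have [_ h] := mx_integralD (measurable_itv `]0, 1[) (beta_kernel_integrable dP1 dQ)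
  (beta_kernel_integrable dP dQ1).
rewrite !BetaE -h; apply: mx_integral_eq => u; rewrite /= in_itv /= => /andP[u0 u1].
by rewrite beta_kernel_add1l// beta_kernel_add1r// -scalerDl -rmorphD /= subrK scale1r.
Qed.

(** Integrates the derivative of [(1 - u) ^ P u ^ Q], which vanishes at both ends. *)
Lemma Beta_recr P Q : GRing.comm P Q -> decays P -> decays Q -> decays (Q + 1) ->
  Beta P (Q + 1) * (P + Q) = Beta P Q * Q.
Proof.
move=> cPQ dP dQ dQ1.
have m01 := measurable_itv (`]0, 1[ : interval R).
have [i1 e1] := mx_integral_lin 1 Q m01 (beta_kernel_integrable dP dQ).
have [i2 e2] := mx_integral_lin 1 (- (P + Q)) m01 (beta_kernel_integrable dP dQ1).
have [i3 e3] := mx_integralD m01 i1 i2.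
apply/esym/eqP; rewrite -subr_eq0 -mulrN; apply/eqP.
rewrite -BetaE mul1r in e1; rewrite -BetaE mul1r in e2.
rewrite e1 e2 in e3; rewrite -e3.
apply: (mx_integral_FTC (F := fun u => mxpow P (1 - u) * mxpow Q u) m01 exhausts01 _ _ i3).
- move=> u; rewrite /= in_itv /= => /andP[u0 u1].
  apply: mx_der_eq (mx_derM (mxpow_onem_der P u1) (mxpow_der Q u0)) _.
  rewrite beta_kernel_add1r// beta_kernelE ?u0// !mul1r.
  set a := (1 - u)^-1; set p := mxpow P _; set q := mxpow Q u.
  have cQ : Q * q = q * Q by exact: mxpow_comm.
  have cP : P * p = p * P by exact: mxpow_comm.
  have cPq : P * q = q * P by exact: mxpow_comm.
  rewrite cP cQ -scalerAl -(mulrA p) cPq -scalerAr !mulrA.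
  rewrite scalerA -rmorphM /= mulrCA divff ?gt_eqF// mulr1 mulrN -!scalerAl mulrDr.
  have -> : a / u = a + u^-1 by rewrite /a; field; rewrite !gt_eqF ?subr_gt0.
  rewrite rmorphD /= scalerDl scalerDr scaleNr; set x := a%:C *: (_ * P); set y := a%:C *: (_ * Q).
  by rewrite (addrC x y) opprD addrA (addrC y) addrK addrC.
- move=> u; rewrite /= in_itv /= => u01.
  by apply: mx_cvgD; (apply: mx_cvgM; last exact: mx_cvg_cst);
    (apply: mx_cvgM; [exact: mx_cvg_cst|exact: beta_kernel_continuous]).
- rewrite (_ : 0 = 0 * 1 - 1 * 0 :> M); last by rewrite mul0r mulr0 subrr.
  apply: mx_cvgB; apply: mx_cvgM.
  + apply: mxpow_cvg0 => // [k|]; first by rewrite subKr in01_invS.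
    by under eq_fun do rewrite subKr; exact: cvg_invS.
  + by apply: mxpow_cvg1; have := cvg_onem (cvg_invS 2); rewrite subr0.
  + by apply: mxpow_cvg1; have := cvg_onem (cvg_invS 2); rewrite subr0.
  + by apply: mxpow_cvg0 => //; [exact: in01_invS|exact: cvg_invS].
Qed.

(** Follows from [Beta_recr] by [Beta_split], since [P = (P + Q) - Q]. *)
Lemma Beta_recl P Q : GRing.comm P Q -> decays P -> decays Q ->
  Beta (P + 1) Q * (P + Q) = Beta P Q * P.
Proof.
move=> cPQ dP dQ.
have h := Beta_recr cPQ dP dQ (decays_add1 dQ).
have -> : Beta (P + 1) Q = Beta P Q - Beta P (Q + 1).
  by rewrite (Beta_split dP dQ (decays_add1 dP) (decays_add1 dQ)) addrK.
by rewrite mulrBl h mulrDr addrK.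
Qed.

Lemma pochS X k : mx_poch X k.+1 = mx_poch X k * (X + (k%:R)%:M).
Proof. by rewrite /mx_poch big_ord_recr. Qed.

Lemma poch0 X : mx_poch X 0 = 1.
Proof. by rewrite /mx_poch big_ord0. Qed.

Lemma comm_addn X Y k : GRing.comm Y X -> GRing.comm Y (X + (k%:R)%:M).
Proof. by move=> h; apply: commrD => //; exact/commr_sym/comm_scalar. Qed.

Lemma comm_poch X Y k : GRing.comm Y X -> GRing.comm Y (mx_poch X k).
Proof.
move=> h; elim: k => [|k IH]; first by rewrite poch0; exact: commr1.
by rewrite pochS; apply: commrM => //; exact: comm_addn.
Qed.

Lemma decays_addn X k : decays X -> decays (X + (k%:R)%:M).
Proof. by move=> dX; have := decays_addr (ler0n _ k) dX; rewrite rmorph_nat. Qed.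

Lemma poch_unit X k : decays X -> mx_poch X k \is a GRing.unit.
Proof.
move=> dX; elim: k => [|k IH]; first by rewrite poch0 unitr1.
rewrite pochS unitrM_comm ?IH ?decays_unit//; first exact: decays_addn.
by apply/commr_sym/comm_poch/commr_sym/comm_addn.
Qed.

(** Both iterated recurrences have this shape. *)
Lemma poch_iter (b : nat -> M) X Y : GRing.comm X Y ->
  (forall k, b k.+1 * (X + (k%:R)%:M) = b k * (Y + (k%:R)%:M)) ->
  forall k, b k * mx_poch X k = b 0 * mx_poch Y k.
Proof.
move=> cXY h; elim=> [|k IH]; first by rewrite !poch0.
have c1 : mx_poch X k * (X + (k%:R)%:M) = (X + (k%:R)%:M) * mx_poch X k.
  by apply/commr_sym/comm_poch/commr_sym/comm_addn.
have c2 : (Y + (k%:R)%:M) * mx_poch X k = mx_poch X k * (Y + (k%:R)%:M).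
  by apply/comm_poch/commr_sym/comm_addn.
by rewrite !pochS c1 mulrA h -mulrA c2 mulrA IH -mulrA.
Qed.

Lemma addn1S X k : X + (k.+1%:R)%:M = X + (k%:R)%:M + 1 :> M.
Proof. by rewrite -addrA -(natr1 k) raddfD. Qed.

Lemma Beta_pochr P Q k : GRing.comm P Q -> decays P -> decays Q ->
  Beta P (Q + (k%:R)%:M) * mx_poch (P + Q) k = Beta P Q * mx_poch Q k.
Proof.
move=> cPQ dP dQ.
rewrite (@poch_iter (fun k => Beta P (Q + (k%:R)%:M)) (P + Q) Q).
- by rewrite raddf0 addr0.
- by apply/commr_sym; apply: commrD => //; exact/commr_sym.
- move=> j; rewrite -addrA addn1S Beta_recr//; [exact: comm_addn|exact: decays_addn|].
  by rewrite -addn1S; exact: decays_addn.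
Qed.

Lemma Beta_pochl P Q k : GRing.comm P Q -> decays P -> decays Q ->
  Beta (P + (k%:R)%:M) Q * mx_poch (P + Q) k = Beta P Q * mx_poch P k.
Proof.
move=> cPQ dP dQ.
rewrite (@poch_iter (fun k => Beta (P + (k%:R)%:M) Q) (P + Q) P).
- by rewrite raddf0 addr0.
- by apply/commr_sym; apply: commrD.
- move=> j; rewrite addrAC addn1S Beta_recl//; last exact: decays_addn.
  by apply/commr_sym/comm_addn/commr_sym.
Qed.

End Beta.

(** * The Gamma function as a limit of Beta integrals *)

(** The cancellation behind [Gamma_Beta]: [bL = b u / w], [bP = f / u] and
    [bPQ = f / w] give [bL bP = b bPQ]. *)
Lemma gamma_alg (T : unitRingType) (q bL p bP b pq bPQ u w f : T) :
  u \is a GRing.unit -> w \is a GRing.unit ->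
  bL * w = b * u -> bP * u = f -> bPQ * w = f -> pq = p * q ->
  (forall x, f * x = x * f) -> p * w = w * p -> p * q = q * p -> b * q = q * b ->
  u * w = w * u -> u * p = p * u ->
  (q * bL) * (p * bP) = b * (pq * bPQ).
Proof.
move=> uu uw hL hP hPQ -> hf cpw cpq cbq cuw cup.
apply: (mulIr uu); apply: (mulIr uw).
have -> : q * bL * (p * bP) * u * w = q * (bL * (p * ((bP * u) * w))).
  by rewrite !mulrA.
have -> : b * (p * q * bPQ) * u * w = b * ((p * q) * (bPQ * (u * w))).
  by rewrite !mulrA.
rewrite hP (hf w) (mulrA p) cpw -(mulrA w) (mulrA bL) hL.
rewrite cuw (mulrA bPQ) hPQ (hf u) cpq -(mulrA q) (mulrA b) cbq -(mulrA q).
by rewrite (mulrA p u) -cup -!mulrA.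
Qed.

Section RealLimits.
Context {R : realType}.

(** Both bounds on [(1 - v / m) ^ m], this one and the next, come from
    [1 + x <= e ^ x]; together they give its limit, and this one dominates it. *)
Lemma onem_expn_le (v : R) k : 0 <= v <= k.+1%:R ->
  (1 - v / k.+1%:R) ^+ k.+1 <= expR (- v).
Proof.
move=> /andP[v0 vk].
have k0 : 0 < k.+1%:R :> R by rewrite ltr0n.
have -> : - v = k.+1%:R * (- (v / k.+1%:R)) by field; rewrite gt_eqF.
rewrite expRM_natl lerXn2r ?nnegrE ?expR_ge0//.
  by rewrite subr_ge0 ler_pdivrMr// mul1r.
exact: expR_ge1Dx.
Qed.

Lemma onem_expn_ge (v : R) k : 0 <= v < k.+1%:R ->
  expR (- (v / (1 - v / k.+1%:R))) <= (1 - v / k.+1%:R) ^+ k.+1.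
Proof.
move=> /andP[v0 vk].
have k0 : 0 < k.+1%:R :> R by rewrite ltr0n.
set x := v / k.+1%:R.
have x1 : 0 < 1 - x by rewrite subr_gt0 ltr_pdivrMr// mul1r.
have -> : - (v / (1 - x)) = k.+1%:R * (- (x / (1 - x))).
  have vx : v = k.+1%:R * x by rewrite /x mulrC divfK// gt_eqF.
  by rewrite {1}vx mulrN -[in LHS]mulrA.
rewrite expRM_natl lerXn2r ?nnegrE ?expR_ge0// ?(ltW x1)//.
rewrite expRN invf_ple ?posrE ?expR_gt0//.
apply: le_trans (expR_ge1Dx _).
by rewrite le_eqVlt; apply/orP; left; apply/eqP; field; rewrite gt_eqF.
Qed.

Lemma cvg_divS (v : R) : v / k.+1%:R @[k --> \oo] --> 0.
Proof.
rewrite -(mulr0 v); apply: cvgMr; have := @cvg_invS R 0.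
by under eq_fun do rewrite addn0.
Qed.

Lemma cvg_onem_expn (v : R) : 0 <= v ->
  (1 - v / k.+1%:R) ^+ k.+1 @[k --> \oo] --> expR (- v).
Proof.
move=> v0.
have h1 : 1 - v / k.+1%:R @[k --> \oo] --> (1 : R).
  by rewrite -[X in _ --> X]subr0; apply: cvgB; [exact: cvg_cst|exact: cvg_divS].
have h2 : - (v / (1 - v / k.+1%:R)) @[k --> \oo] --> - v.
  apply: cvgN; rewrite -[X in _ --> X]divr1; apply: cvgMr.
  by apply: cvgV => //; rewrite oner_eq0.
have h3 : expR (- (v / (1 - v / k.+1%:R))) @[k --> \oo] --> expR (- v).
  exact: (cvg_comp _ _ h2 (@continuous_expR R (- v))).
apply: (@squeeze_cvgr _ _ _ _ _ (fun=> expR (- v)) _ _ _ h3); last exact: cvg_cst.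
have := nbhs_infty_gtr v; apply: filterS => k hk.
have hk1 : v < k.+1%:R by apply: lt_le_trans hk _; rewrite ler_nat.
by rewrite onem_expn_ge ?v0//= onem_expn_le// v0 ltW.
Qed.

End RealLimits.

Section Gamma.
Context {R : realType} {n : nat}.
Local Notation C := R[i].
Local Notation M := 'M[C]_n.+1.
Implicit Types (X Y P Q S : M) (s t u v : R).

Lemma mx_cvg_near (f g : nat -> M) X : (\forall k \near \oo, f k = g k) ->
  mx_cvg \oo f X -> mx_cvg \oo g X.
Proof.
move=> h hf c; apply: cvg_trans (hf c); apply: near_eq_cvg.
by apply: filterS h => k ->.
Qed.

Lemma mx_integral_indic D E (F : R -> M) :
  mx_integral (D `&` E) F = mx_integral D (fun s => (\1_E s)%:C *: F s).
Proof.
apply: rcoord_inj => c; rewrite !rcoord_mx_integral /Rint Rintegral_mkcondr.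
congr (Rintegral _ _ _); apply/funext => s; rewrite patch_indic /= rcoordZ mulrC.
by [].
Qed.

(** The power [(1 - v / m) ^ (S + m)] replaces [e ^ (- v)] in the Gamma integral; the
    indicator is that of the interval on which it makes sense. *)
Definition Gamma_approx S Q k v : M :=
  (\1_(`]-oo, k.+1%:R[ : set R) v)%:C *:
  (mxpow (S + (k.+1%:R)%:M) (1 - v / k.+1%:R) * mxpow (Q - 1) v).

(** The scaling [v = m u]. *)
Lemma Gamma_approxE S Q k : GRing.comm S Q -> decays (S + 1) -> decays Q ->
  mx_integral `]0, +oo[ (Gamma_approx S Q k) =
  mxpow Q k.+1%:R * Beta (S + 1 + (k.+1%:R)%:M) Q.
Proof.
move=> cSQ dS dQ; have k0 : 0 < k.+1%:R :> R by rewrite ltr0n.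
rewrite -mx_integral_indic.
have -> : [set` `]0, +oo[] `&` [set` `]-oo, k.+1%:R[] = [set` `]0, k.+1%:R[] :> set R.
  apply/seteqP; split => x; rewrite /= !in_itv /= andbT; first by move=> [-> ->].
  by move=> /andP[].
have e01 : (fun u : R => 0 + k.+1%:R * u) @^-1` [set` `]0, k.+1%:R[] = [set` `]0, 1[].
  apply/seteqP; split => x; rewrite /= !in_itv /= add0r pmulr_rgt0// => /andP[-> h] /=.
    by rewrite -(ltr_pM2l k0) mulr1.
  by rewrite -[ltRHS]mulr1 ltr_pM2l.
set F := fun v : R => _.
have mF : mx_measurable F.
  apply: mx_measurableM; apply: mx_measurable_mxpow => //.
  by apply: measurable_funB => //; exact: measurable_funM.
have FE u : `]0, 1[%classic u -> F (0 + k.+1%:R * u) =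
    mxpow (Q - 1) k.+1%:R * beta_kernel (S + 1 + (k.+1%:R)%:M) Q u * 1.
  rewrite /= in_itv /= => /andP[u0 u1]; rewrite /F add0r mulr1 /beta_kernel.
  rewrite mxpowM// (mulrC k.+1%:R u) mulfK ?gt_eqF// addrAC addrK !mulrA.
  congr (_ * _); apply: mxpow_comm; apply: commr_sym; apply: mxpow_comm.
  apply: comm_addn; apply: commr_sym.
  by apply: commrB => //; exact: commr1.
have dS1 : decays (S + 1 + (k.+1%:R)%:M) by exact: decays_addn.
have m01 := measurable_itv (`]0, 1[ : interval R).
have [i1 e1] := mx_integral_lin (mxpow (Q - 1) k.+1%:R) 1 m01 (beta_kernel_integrable dS1 dQ).
have i2 : mx_integrable ((fun u : R => 0 + k.+1%:R * u) @^-1` [set` `]0, k.+1%:R[])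
    (fun u => F (0 + k.+1%:R * u)).
  by rewrite e01; apply: mx_integrable_eq i1 => // u /FE ->.
have [_ ->] := mx_integral_affine k0 (measurable_itv _) mF i2.
rewrite e01 (mx_integral_eq FE) e1 mulr1 -BetaE scalerAl -mxpow_add1//.
by rewrite subrK.
Qed.

(** The fixed exponent [S] disappears in the limit.  Only boundedness of [S]-th powers
    near [0] is asked, so that [S = 0] is allowed besides decaying [S]. *)
Lemma Gamma_limit S Q : GRing.comm S Q -> bounded01 S -> decays (S + 1) -> decays Q ->
  mx_cvg \oo (fun k => mxpow Q k.+1%:R * Beta (S + 1 + (k.+1%:R)%:M) Q) (mx_Gamma Q).
Proof.
move=> cSQ [KS KS0 hKS] dS dQ.
have [a [a0 [K K0 hK]]] := mxpow_decay dQ.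
have m0 : 0 <= nrm Q by [].
have [K1 K10 hK1] := gamma_majorant_ge a0 m0.
set N := nrm (1 : M).
have hQ v : 0 < v -> nrm (mxpow Q v) <=
    (K + N) * (if v <= 1 then expR (a * ln v) else expR (nrm Q * ln v)).
  move=> v0; case: ifPn => v1.
    apply: (@le_trans _ _ (K * expR (a * ln v))); first by apply: hK; rewrite v0.
    by rewrite ler_wpM2r ?expR_ge0// lerDl /N.
  apply: (@le_trans _ _ (N * expR (nrm Q * ln v))).
    apply: le_trans (nrm_mexp _ _) _; rewrite ger0_norm; last first.
      by rewrite ln_ge0// ltW// ltNge.
    by rewrite mulrC (mulrC (ln v)) mulrC.
  by rewrite ler_wpM2r ?expR_ge0// lerDr.
have -> : mx_Gamma Q = mx_integral `]0, +oo[ (fun v => (expR (- v))%:C *: (1 * mxpow (Q - 1) v)).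
  by apply: mx_integral_eq => v _; rewrite mul1r mxpow_rpow.
under eq_fun do rewrite -Gamma_approxE//.
suff [_ //] : mx_integrable `]0, +oo[ (fun v => (expR (- v))%:C *: (1 * mxpow (Q - 1) v)) /\
  mx_cvg \oo (fun k => mx_integral `]0, +oo[ (Gamma_approx S Q k)) (mx_integral `]0, +oo[
    (fun v => (expR (- v))%:C *: (1 * mxpow (Q - 1) v))).
apply: (mx_dct (g := fun v => KS * (K + N) * K1 * gamma_majorant a v)) => //.
- move=> k; apply: mx_measurableZ; first exact: measurable_indic.
  apply: mx_measurableM; apply: mx_measurable_mxpow => //.
  by apply: measurable_funB => //; exact: measurable_funM.
- move=> v; rewrite /= in_itv /= andbT => v0.
  apply: (@mx_cvg_near (fun k => ((1 - v / k.+1%:R) ^+ k.+1)%:C *: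
     (mxpow S (1 - v / k.+1%:R) * mxpow (Q - 1) v))).
    have := nbhs_infty_gtr v; apply: filterS => k hk.
    have hk1 : v < k.+1%:R by apply: lt_le_trans hk _; rewrite ler_nat.
    rewrite /Gamma_approx indicE mem_set ?scale1r; last by rewrite /= in_itv.
    by rewrite mxpow_addn -?scalerAl// subr_gt0 ltr_pdivrMr ?mul1r// ltr0n.
  apply: mx_cvgZ; first by apply: cvg_onem_expn; exact: ltW.
  apply: mx_cvgM (mx_cvg_cst _); apply: mxpow_cvg1.
  by have := cvg_onem (cvg_divS v); rewrite subr0.
- move=> k v; rewrite /= in_itv /= andbT => v0.
  have gm : 0 <= gamma_majorant a v by exact: expR_ge0.
  have k0 : 0 < k.+1%:R :> R by rewrite ltr0n.
  rewrite /Gamma_approx indicE; case: (ltP v k.+1%:R) => vk; last first.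
    rewrite memNset ?scale0r ?nrm0; last by rewrite /= in_itv /= ltNge vk.
    by rewrite !mulr_ge0// addr_ge0// /N.
  rewrite mem_set ?scale1r; last by rewrite /= in_itv.
  have w0 : 0 < 1 - v / k.+1%:R by rewrite subr_gt0 ltr_pdivrMr// mul1r.
  rewrite mxpow_addn// mxpow_sub1// -scalerAl -scalerAr scalerA -rmorphM nrmZ.
  rewrite ger0_norm; last by rewrite mulr_ge0 ?exprn_ge0 ?invr_ge0 ?ltW.
  have h1 : nrm (mxpow S (1 - v / k.+1%:R) * mxpow Q v) <=
      KS * ((K + N) * (if v <= 1 then expR (a * ln v) else expR (nrm Q * ln v))).
    rewrite (le_trans (nrmM _ _))//; apply: ler_pM => //; last exact: hQ.
    by apply: hKS; rewrite w0 gerBl divr_ge0 ?ltW.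
  have h2 : (1 - v / k.+1%:R) ^+ k.+1 / v <= expR (- v) / v.
    rewrite ler_wpM2r ?invr_ge0 ?(ltW v0)// onem_expn_le//.
    by rewrite (ltW v0) (ltW vk).
  apply: (@le_trans _ _ (expR (- v) / v * (KS * ((K + N) *
     (if v <= 1 then expR (a * ln v) else expR (nrm Q * ln v)))))).
    apply: ler_pM => //.
    by rewrite mulr_ge0 ?exprn_ge0 ?invr_ge0 ?(ltW v0) ?(ltW w0).
  have c0 : 0 <= KS * (K + N) by rewrite mulr_ge0// addr_ge0// /N.
  have alg (x y c W : R) : x * y * (KS * (c * W)) = KS * c * (W * x * y) by ring.
  by rewrite alg -(mulrA (KS * (K + N))) ler_wpM2l// hK1.
- have [h _] := Rintegrable_lin [:: tt] (fun=> KS * (K + N) * K1)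
    (measurable_itv `]0, +oo[) (fun=> Rintegrable_gamma_majorant a0).
  by apply: eq_integrable h => // v _; congr EFin; rewrite big_cons big_nil addr0.
Qed.

End Gamma.

(** * Product formula and invertibility of Gamma *)

Section GammaBeta.
Context {R : realType} {n : nat}.
Local Notation C := R[i].
Local Notation M := 'M[C]_n.+1.
Implicit Types (X Y P Q S : M) (s t u v : R).

Lemma comm_Beta P Q Y : decays P -> decays Q -> GRing.comm Y P -> GRing.comm Y Q ->
  GRing.comm Y (Beta P Q).
Proof.
move=> dP dQ cP cQ; rewrite BetaE.
have m01 := measurable_itv (`]0, 1[ : interval R).
have i0 := beta_kernel_integrable dP dQ.
have [_ e1] := mx_integral_lin Y 1 m01 i0.
have [_ e2] := mx_integral_lin 1 Y m01 i0.
rewrite /GRing.comm -[LHS]mulr1 -[X in _ = X * _]mul1r -e1 -e2.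
apply: mx_integral_eq => u _; rewrite mulr1 mul1r /beta_kernel.
by apply: commrM; apply: mxpow_comm; apply: commrB => //; exact: commr1.
Qed.

(** Starting from [B(1, X) = X ^ -1], this is [B(1 + k, X) = k! (X)_(k+1) ^ -1]. *)
Lemma Beta1_poch X k : decays X ->
  Beta (1 + (k%:R)%:M) X * mx_poch X k.+1 = (k`!%:R)%:M.
Proof.
move=> dX.
have d1 j : decays (1 + (j%:R)%:M : M) by exact/decays_addn/decays1.
elim: k => [|k IH].
  rewrite raddf0 addr0 pochS poch0 mul1r raddf0 addr0.
  rewrite -(comm_Beta decays1 dX (commr1 X) (commr_refl X)).
  by rewrite Beta1.
have c1 : GRing.comm (1 + (k%:R)%:M) X.
  by apply: commr_sym; apply: comm_addn; exact: commr1.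
rewrite pochS (_ : mx_poch X k.+1 * _ = (X + (k.+1%:R)%:M) * mx_poch X k.+1); last first.
  by apply/commr_sym/comm_poch/commr_sym/comm_addn.
have -> : X + (k.+1%:R)%:M = 1 + (k%:R)%:M + X.
  by rewrite addn1S addrC addrA (addrAC _ X) addrAC.
rewrite addn1S mulrA Beta_recl// -mulrA.
have cen (b m : M) : b * ((1 + (k%:R)%:M) * m) = (k.+1%:R)%:M * (b * m).
  have -> : 1 + (k%:R)%:M = (k.+1%:R)%:M :> M by rewrite -(natr1 k) raddfD addrC.
  by rewrite mulrA -(comm_scalar _ b) mulrA.
by rewrite cen IH -(scalemx1 n.+1 k.+1%:R) -scalerAl mul1r scale_scalar_mx -natrM.
Qed.

(** For [m = k + 1] the approximations of [Gamma_limit] satisfy exactly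
    [m ^ Q B(P + 1 + m, Q) * m ^ P B(1 + m, P) = B(P, Q) * m ^ (P + Q) B(1 + m, P + Q)],
    as all the Pochhammer symbols cancel. *)
Lemma Gamma_Beta P Q : GRing.comm P Q -> decays P -> decays Q ->
  mx_Gamma Q * mx_Gamma P = Beta P Q * mx_Gamma (P + Q).
Proof.
move=> cPQ dP dQ; have cQP := commr_sym cPQ.
have dPQ := decaysD cPQ dP dQ.
have cPPQ : GRing.comm P (P + Q) by exact: commrD.
have d01 : decays (0 + 1 : M) by rewrite add0r; exact: decays1.
have h1 := Gamma_limit cPQ (decays_bounded01 dP) (decays_add1 dP) dQ.
have h2 := Gamma_limit (commr_sym (commr0 P)) (bounded01_0) d01 dP.
have h3 := Gamma_limit (commr_sym (commr0 (P + Q))) (bounded01_0) d01 dPQ.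
apply: (mx_cvg_unique (F := \oo) (mx_cvgM h1 h2)).
have := mx_cvgM (mx_cvg_cst (Beta P Q)) h3 => /(_ _) h4.
apply: mx_cvg_near (h4 _); apply: nearW => k; apply/esym.
have e1 : P + 1 + (k.+1%:R)%:M = P + (k.+2%:R)%:M by rewrite addrAC -addn1S.
apply: (gamma_alg (u := mx_poch P k.+2) (w := mx_poch (P + Q) k.+2)
  (f := (k.+1`!%:R)%:M)).
- exact: poch_unit.
- exact: poch_unit.
- by rewrite e1 Beta_pochl.
- by rewrite add0r Beta1_poch.
- by rewrite add0r Beta1_poch.
- exact: mxpow_add.
- exact: comm_scalar.
- by apply: comm_poch; apply/commr_sym/mxpow_comm/commr_sym.
- by apply: mxpow_comm; apply/commr_sym/mxpow_comm.
- by apply: mxpow_comm; apply/commr_sym/comm_Beta.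
- by apply: comm_poch; apply/commr_sym/comm_poch.
- by apply: mxpow_comm; apply/commr_sym/comm_poch.
Qed.

(** The Euler product for the inverse of Gamma: [(X)_(m+1) m ^ (- X) / m!] with
    [m = k + 1]. *)
Definition Gamma_inv_approx X k : M :=
  (k.+1`!%:R^-1 : R)%:C *: (mx_poch X k.+2 * mexp X (- ln (k.+1%:R))).

Lemma Gamma_inv_approxK X k : decays X ->
  mxpow X k.+1%:R * Beta (0 + 1 + (k.+1%:R)%:M) X * Gamma_inv_approx X k = 1.
Proof.
move=> dX; rewrite add0r /Gamma_inv_approx -scalerAr mulrA -(mulrA (mxpow X _)).
rewrite Beta1_poch// -(comm_scalar _ (mxpow X _)) -mulrA mexpKN mulr1.
rewrite -scalemx1 scalerA fmorphV rmorph_nat mulVf ?scale1r//.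
Qed.

Definition ratio_factor X (h : R) : M := (1 + h%:C *: X) * mxpow X (1 - h).

(** With [h = 1 / (k + 2)], the new Pochhammer factor is [(k + 2) (1 + h X)], whose
    scalar part is absorbed by the factorial, and [(k + 1) / (k + 2) = 1 - h]. *)
Lemma Gamma_inv_approxS X k :
  Gamma_inv_approx X k.+1 = Gamma_inv_approx X k * ratio_factor X (k.+2%:R^-1).
Proof.
have k1 : 0 < k.+1%:R :> R by rewrite ltr0n.
have k2 : 0 < k.+2%:R :> R by rewrite ltr0n.
have e : - ln (k.+2%:R : R) = - ln (k.+1%:R) + ln (1 - (k.+2%:R)^-1).
  have -> : 1 - (k.+2%:R)^-1 = k.+1%:R / k.+2%:R :> R.
    rewrite (_ : k.+1%:R = k.+2%:R - 1 :> R); last by rewrite -(natr1 k.+1) addrK.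
    by rewrite mulrBl divff ?gt_eqF// mul1r.
  by rewrite ln_div ?posrE//; ring.
rewrite /Gamma_inv_approx /ratio_factor pochS e mexpD -/(mxpow X _).
set m := mx_poch X k.+2; set q := mexp X _; set p := mxpow X _.
set Y := 1 + _.
have cq : Y * q = q * Y.
  apply: mexp_comm; apply: commr_sym; apply: commrD; first exact: commr1.
  by rewrite /GRing.comm -scalerAr -scalerAl.
have -> : X + (k.+2%:R)%:M = (k.+2%:R : R)%:C *: Y.
  rewrite scalerDr scalerA -rmorphM divff ?gt_eqF// rmorph1 scale1r.
  by rewrite scalemx1 !rmorph_nat addrC.
rewrite -scalerAr -!scalerAl scalerA -rmorphM; congr (_ *: _).
  by congr (_%:C); rewrite factS natrM invfM mulrAC mulVf ?mul1r// gt_eqF.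
by rewrite !mulrA -(mulrA m) cq mulrA.
Qed.

(** The terms of order zero in [h] cancel, as the derivatives [X] and [- X] of the two
    factors are opposite at [h = 0]. *)
Lemma ratio_factor_der X (h : R) : h < 1 -> mx_der (ratio_factor X) h
  (- (h / (1 - h))%:C *: ((X + X * X) * mxpow X (1 - h))).
Proof.
move=> h1; have w0 : 0 < 1 - h by rewrite subr_gt0.
have d1 : mx_der (fun h : R => 1 + h%:C *: X) h X.
  have := mx_derD (mx_der_cst (1 : M) h) (mx_derZ (is_derive_id h 1) (mx_der_cst X h)).
  by rewrite scaler0 addr0 add0r rmorph1 scale1r.
apply: mx_der_eq (mx_derM d1 (mxpow_onem_der X h1)) _.
set p := mxpow X _.
have -> : (h / (1 - h))%:C = ((1 - h)^-1)%:C - 1 :> C.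
  by rewrite -(rmorph1 (real_complex R)) -rmorphB; congr (_%:C); field; rewrite gt_eqF.
have hc : h%:C * ((1 - h)^-1)%:C = ((1 - h)^-1)%:C - 1 :> C.
  rewrite -rmorphM -(rmorph1 (real_complex R)) -rmorphB; congr (_%:C).
  by field; rewrite gt_eqF.
move: ((1 - h)^-1)%:C hc => c hc; set y := X * p.
rewrite !mulrDl -mulrA -/y mul1r -scalerAl -scalerAr scalerA mulrN hc addrA scalerDr.
by congr (_ + _); rewrite -{1}(scale1r y) -scalerDl opprB.
Qed.

(** The derivative vanishes linearly at [0], so the distance to the value [1] at [0] is
    quadratic. *)
Lemma ratio_factor_le X : decays X -> exists2 c, 0 <= c &
  forall h : R, 0 <= h <= 2^-1 -> nrm (ratio_factor X h - 1) <= c * h ^+ 2.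
Proof.
move=> /decays_bounded01[K K0 hK].
pose d := nrm (X + X * X) * K.
have d0 : 0 <= d by rewrite mulr_ge0.
exists (@ncoord R n * d) => [|h /andP[h0 h2]]; first by rewrite mulr_ge0// ncoord_ge0.
have -> : 1 = ratio_factor X 0 by rewrite /ratio_factor scale0r addr0 mul1r subr0 mxpow1.
have -> : @ncoord R n * d * h ^+ 2 = @ncoord R n * (d * h ^+ 2 - d * 0 ^+ 2).
  by rewrite expr0n /= mulr0 subr0 mulrA.
apply: (mx_der_le (g := fun x => d * x ^+ 2) (g' := fun x => d * (2 * x)) h0
  (f' := fun h => - (h / (1 - h))%:C *: ((X + X * X) * mxpow X (1 - h)))).
- by move=> x /andP[x0 xh]; apply: ratio_factor_der; lra.
- move=> x _; have -> : (fun x => d * x ^+ 2) = d *: ((@id R) * (@id R)).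
    by apply/funext => y; rewrite expr2.
  have h' := is_deriveZ d (is_deriveM (is_derive_id x 1) (is_derive_id x 1)).
  by apply: is_derive_eq h' _; rewrite /GRing.scale /=; ring.
- move=> x /andP[x0 xh].
  have w0 : 0 < 1 - x by lra.
  rewrite -rmorphN nrmZ normrN ger0_norm; last by rewrite divr_ge0// ltW.
  rewrite mulrC; apply: ler_pM => //; first by rewrite divr_ge0// ltW.
    apply: le_trans (nrmM _ _) _; rewrite ler_wpM2l//.
    by apply: hK; rewrite w0 gerBl.
  by rewrite ler_pdivrMr//; nra.
Qed.

(** The increments are controlled by [c h ^ 2], which telescopes through
    [(k + 2) ^ -2 <= (k + 1) ^ -1 - (k + 2) ^ -1]. *)
Lemma Gamma_inv_approx_bounded X : decays X -> exists2 B, 0 < B &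
  forall k, nrm (Gamma_inv_approx X k) <= B.
Proof.
move=> /ratio_factor_le[c c0 hc].
have h k : nrm (Gamma_inv_approx X k) <=
    nrm (Gamma_inv_approx X 0) * expR (c * (1 - k.+1%:R^-1)).
  elim: k => [|k IH]; first by rewrite invr1 subrr mulr0 expR0 mulr1.
  have k1 : 0 < k.+1%:R :> R by rewrite ltr0n.
  have k2 : k.+2%:R = k.+1%:R + 1 :> R by rewrite natr1.
  set x : R := k.+2%:R^-1.
  have x0 : 0 <= x by rewrite invr_ge0.
  have x2 : x <= 2^-1 by rewrite /x lef_pV2 ?posrE// ler_nat.
  have hx : x ^+ 2 <= k.+1%:R^-1 - x.
    rewrite /x k2; have -> : k.+1%:R^-1 - (k.+1%:R + 1)^-1 = (k.+1%:R * (k.+1%:R + 1))^-1 :> R.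
      by field; rewrite !gt_eqF// addr_gt0.
    by rewrite exprVn lef_pV2 ?posrE ?exprn_gt0 ?mulr_gt0 ?addr_gt0//; nra.
  rewrite Gamma_inv_approxS -/x.
  set G := Gamma_inv_approx X k.
  have -> : G * ratio_factor X x = G + G * (ratio_factor X x - 1).
    by rewrite mulrBr mulr1 addrC subrK.
  apply: le_trans (nrmD _ _) _.
  have e1 : nrm (G * (ratio_factor X x - 1)) <= nrm G * (c * x ^+ 2).
    by apply: le_trans (nrmM _ _) _; rewrite ler_wpM2l// hc// x0.
  apply: (@le_trans _ _ (nrm G * (1 + c * x ^+ 2))); first by rewrite [leRHS]mulrDr mulr1 lerD2l.
  apply: (@le_trans _ _ (nrm G * expR (c * x ^+ 2))).
    by rewrite ler_wpM2l// expR_ge1Dx.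
  apply: le_trans (ler_wpM2r (expR_ge0 _) IH) _.
  rewrite -mulrA -expRD ler_wpM2l// ler_expR -mulrDr ler_wpM2l//.
  have alg (y z w : R) : w <= y - z -> 1 - y + w <= 1 - z by lra.
  exact: alg hx.
exists (nrm (Gamma_inv_approx X 0) * expR c + 1).
  by rewrite ltr_wpDl// mulr_ge0// expR_ge0.
move=> k; apply: le_trans (h k) _.
have : expR (c * (1 - k.+1%:R^-1)) <= expR c.
  by rewrite ler_expR ler_piMr// gerBl invr_ge0.
move=> /(ler_wpM2l (nrm_ge0 (Gamma_inv_approx X 0))); lra.
Qed.

(** The Euler approximations of the Gamma function are invertible with bounded
    inverses, so that their limit is invertible. *)
Lemma Gamma_unit X : decays X -> mx_Gamma X \is a GRing.unit.
Proof.
move=> dX; have [B B0 hB] := Gamma_inv_approx_bounded dX.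
have d01 : decays (0 + 1 : M) by rewrite add0r; exact: decays1.
have h := Gamma_limit (commr_sym (commr0 X)) (bounded01_0) d01 dX.
pose L k := mxpow X k.+1%:R * Beta (0 + 1 + (k.+1%:R)%:M) X.
have h1 : mx_cvg \oo (fun k => L k - mx_Gamma X) (mx_Gamma X - mx_Gamma X).
  by apply: mx_cvgB; [exact: h|exact: mx_cvg_cst].
have h2 : nrm (L k - mx_Gamma X) @[k --> \oo] --> 0.
  by have := mx_cvg_nrm h1; rewrite subrr nrm0; apply.
have B1 : 0 < B^-1 by rewrite invr_gt0.
move/cvgrPdist_lt : h2 => /(_ _ B1) [k _ /(_ k (leqnn _))] /=.
rewrite sub0r normrN ger0_norm// => hk.
have u1 : nrm (1 - mx_Gamma X * Gamma_inv_approx X k) < 1.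
  rewrite -(Gamma_inv_approxK k dX) -/(L k) -mulrBl; apply: le_lt_trans (nrmM _ _) _.
  apply: (@le_lt_trans _ _ (nrm (L k - mx_Gamma X) * B)).
    by rewrite ler_wpM2l.
  by rewrite -ltr_pdivlMr// mul1r.
have : mx_Gamma X *m Gamma_inv_approx X k \in unitmx := nrm_unit u1.
by rewrite unitmx_mul => /andP[].
Qed.

End GammaBeta.

(** * Integrals of hypergeometric series *)

Lemma quot_alg (T : pzRingType) (a b c a1 b1 c1 : T) :
  GRing.comm a1 b -> GRing.comm a1 c -> GRing.comm b1 b -> GRing.comm b1 c ->
  GRing.comm c1 c ->
  a * a1 * (b1 * b) * (c1 * c) = a * b * c * (a1 * b1 * c1).
Proof.
move=> h1 h2 h3 h4 h5.
have e1 : c * (a1 * b1 * c1) = a1 * b1 * c1 * c.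
  by apply: commrM; [apply: commrM|]; exact: commr_sym.
have e2 : b * (a1 * b1) = a1 * b1 * b by apply: commrM; exact: commr_sym.
by rewrite -(mulrA _ c) e1 -(mulrA _ c1) (mulrA _ (a1 * b1)) -(mulrA a b) e2 !mulrA.
Qed.

Lemma div_alg (T : unitRingType) (a b g : T) :
  a = b * g -> g \is a GRing.unit -> b = a * g^-1.
Proof. by move=> -> gu; rewrite mulrK. Qed.

Lemma unit_alg (T : unitRingType) (a b c : T) : a \is a GRing.unit ->
  b \is a GRing.unit -> c \is a GRing.unit -> a * b * c^-1 \is a GRing.unit.
Proof. by move=> ua ub uc; rewrite unitrMr ?unitrV// unitrMr. Qed.

Lemma solve_alg (T : unitRingType) (w b b' p v : T) : w = b * p -> b = b' ->
  w \is a GRing.unit -> v = b' * p * (w^-1 * v).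
Proof. by move=> -> <- uw; rewrite mulVKr. Qed.

Lemma term_alg (K : comPzRingType) (T : algType K) (p q g : T) (c d e : K) :
  c * d = e -> 1 * (p * (c *: q)) * (d *: g) = p * q * (e *: g).
Proof. by move=> <-; rewrite mul1r -!scalerAr -scalerAl scalerA mulrC. Qed.

Section Hypergeometric.
Context {R : realType} {n : nat}.
Local Notation C := R[i].
Local Notation M := 'M[C]_n.+1.
Implicit Types (A B E X Y P Q : M) (s t u v x : R) (z : C).

Lemma mexp_unit X s : mexp X s \is a GRing.unit.
Proof. by apply/unitrP; exists (mexp X (- s)); rewrite mexpNK mexpKN. Qed.

(** Commutation is inherited from the approximations of [Gamma_limit]. *)
Lemma comm_Gamma X Y : decays X -> GRing.comm Y X -> GRing.comm Y (mx_Gamma X).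
Proof.
move=> dX cYX.
have d01 : decays (0 + 1 : M) by rewrite add0r; exact: decays1.
have h := Gamma_limit (commr_sym (commr0 X)) (bounded01_0) d01 dX.
apply: (mx_cvg_unique (F := \oo) (mx_cvgM (mx_cvg_cst Y) h)).
apply: mx_cvg_near (mx_cvgM h (mx_cvg_cst Y)); apply: nearW => k; apply/esym.
apply: commrM; first exact: mxpow_comm.
apply: comm_Beta => //; first exact: decays_addn.
by apply: comm_addn; rewrite add0r; exact: commr1.
Qed.

(** [k (X + k)^-1 = 1 - X (X + k)^-1], which bounds the inverse for large [k]. *)
Lemma inv_addn_le X : decays X -> exists2 K, 0 <= K &
  forall k, k.+1%:R * nrm (X + (k%:R)%:M)^-1 <= K.
Proof.
move=> dX; set N := nrm (1 : M).
have [k0 hk0] : exists k0, forall k, (k0 <= k)%N -> 2 * nrm X + 1 <= k%:R.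
  have [k0 _ h] := nbhs_infty_ger (2 * nrm X + 1).
  by exists k0 => k /h.
pose c k := k.+1%:R * nrm (X + (k%:R)%:M)^-1.
have c0 k : 0 <= c k by rewrite mulr_ge0.
exists (2 * N + \sum_(j < k0) c j) => [|k].
  by rewrite addr_ge0 ?mulr_ge0 ?sumr_ge0// /N.
rewrite -/(c k); have [kk|kk] := ltnP k k0.
  rewrite (bigD1 (Ordinal kk)) //= addrCA lerDl addr_ge0 ?mulr_ge0 ?sumr_ge0//.
  exact: nrm_ge0.
apply: (@le_trans _ _ (2 * N)); last by rewrite lerDl sumr_ge0.
have := hk0 _ kk => hk; rewrite /c; set Z := _^-1.
have eZ : (k%:R : R)%:C *: Z = 1 - X * Z.
  have hu := decays_unit (decays_addn k dX).
  by rewrite -(mulrV hu) -/Z mulrDl addrC addKr rmorph_nat -scalemx1 -scalerAl mul1r.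
have : k%:R * nrm Z <= N + nrm X * nrm Z.
  have -> : k%:R * nrm Z = nrm ((k%:R : R)%:C *: Z) by rewrite nrmZ ger0_norm.
  by rewrite eZ (le_trans (nrmB _ _))// lerD2l nrmM.
rewrite -natr1; have := nrm_ge0 Z; have := nrm_ge0 X.
move: (nrm Z) (nrm X) (k%:R) hk => z' x' k' hk _ z0 h.
have : 0 <= z' * (k' - 2 * x' - 1) by apply: mulr_ge0 => //; lra.
lra.
Qed.

Definition coef_1F2 A B E k : M := mx_poch A k * (mx_poch B k)^-1 * (mx_poch E k)^-1.

Lemma coef_1F2S A B E k : GRing.comm A B -> GRing.comm A E -> GRing.comm B E ->
  decays B -> decays E ->
  coef_1F2 A B E k.+1 = coef_1F2 A B E k *
   ((A + (k%:R)%:M) * (B + (k%:R)%:M)^-1 * (E + (k%:R)%:M)^-1).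
Proof.
move=> cAB cAE cBE dB dE.
have cV X Y : GRing.comm X Y -> GRing.comm (X + (k%:R)%:M) (mx_poch Y k)^-1.
  move=> h; apply: commrV; apply: comm_poch; apply: commr_sym; apply: comm_addn.
  exact: commr_sym.
have iV X : decays X ->
    (mx_poch X k.+1)^-1 = (X + (k%:R)%:M)^-1 * (mx_poch X k)^-1.
  by move=> dX; rewrite pochS invrM// ?poch_unit// decays_unit//; exact: decays_addn.
rewrite /coef_1F2 (iV _ dB) (iV _ dE) pochS.
have cVV X Y : GRing.comm X Y -> GRing.comm (X + (k%:R)%:M)^-1 (mx_poch Y k)^-1.
  by move=> /cV/commr_sym/commrV/commr_sym.
by apply: quot_alg; [exact: cV|exact: cV|exact: cVV|exact: cVV|exact: cVV].
Qed.

(** In the ratio of consecutive coefficients, [A + k] is compensated by [(B + k) ^ -1],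
    and [(E + k) ^ -1] is bounded. *)
Lemma coef_1F2_le A B E : GRing.comm A B -> GRing.comm A E -> GRing.comm B E ->
  decays B -> decays E -> exists2 L, 0 <= L &
  forall k, nrm (coef_1F2 A B E k) <= nrm (1 : M) * L ^+ k.
Proof.
move=> cAB cAE cBE dB dE.
have [K K0 hK] := inv_addn_le dB; have [K' K'0 hK'] := inv_addn_le dE.
exists ((nrm A + nrm (1 : M)) * K * K') => [|k].
  by rewrite !mulr_ge0// addr_ge0.
elim: k => [|k IH]; first by rewrite /coef_1F2 !poch0 !invr1 !mulr1.
rewrite coef_1F2S// exprSr [leRHS]mulrA (le_trans (nrmM _ _))//; apply: ler_pM => //.
apply: le_trans (nrmM _ _) _; apply: ler_pM => //.
  apply: le_trans (nrmM _ _) _.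
  apply: (@le_trans _ _ ((nrm A + nrm (1 : M)) * (k.+1%:R * nrm (B + (k%:R)%:M)^-1))).
    rewrite mulrA ler_wpM2r//; apply: le_trans (nrmD _ _) _.
    have -> : nrm ((k%:R)%:M : M) = k%:R * nrm (1 : M).
      by have := nrm_scalar (n := n) (k%:R : R); rewrite rmorph_nat => ->; rewrite ger0_norm.
    rewrite mulrDl lerD//.
      by rewrite ler_peMr// ler1n.
    by rewrite mulrC ler_wpM2l// ler_nat.
  by rewrite ler_wpM2l// addr_ge0.
by apply: le_trans (hK' k); rewrite ler_peMl// ler1n.
Qed.

Lemma cabs_coef z k : cabs (z ^+ k / k`!%:R) <= cabs z ^+ k / k`!%:R.
Proof.
have -> : (k`!%:R : C)^-1 = ((k`!%:R : R)^-1)%:C by rewrite fmorphV rmorph_nat.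
apply: le_trans (cabsM _ _) _; apply: ler_pM => //; first exact: cabsX.
by rewrite /cabs /= normr0 addr0 ger0_norm.
Qed.

Lemma mx_1F2_cvg A B E : GRing.comm A B -> GRing.comm A E -> GRing.comm B E ->
  decays B -> decays E -> exists2 L, 0 <= L & forall z,
  mx_cvg \oo (series (fun k => (z ^+ k / k`!%:R) *: coef_1F2 A B E k)) (mx_1F2 A B E z) /\
  forall k, nrm (series (fun k => (z ^+ k / k`!%:R) *: coef_1F2 A B E k) k) <=
    nrm (1 : M) * expR (cabs z * L).
Proof.
move=> cAB cAE cBE dB dE.
have [L L0 hL] := coef_1F2_le cAB cAE cBE dB dE.
exists L => // z.
have vE : (fun k => nrm (1 : M) * exp_coeff (cabs z * L) k) =
    nrm (1 : M) *: exp_coeff (cabs z * L) :> (nat -> R) by apply/funext.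
have [|| G [hG bG]] := @mx_cvg_series R n (fun k => (z ^+ k / k`!%:R) *: coef_1F2 A B E k)
  (fun k => nrm (1 : M) * exp_coeff (cabs z * L) k).
- move=> k; apply: le_trans (nrmZc _ _) _; rewrite /exp_coeff /= exprMn.
  have -> : nrm (1 : M) * (cabs z ^+ k * L ^+ k / k`!%:R) =
    (cabs z ^+ k / k`!%:R) * (nrm (1 : M) * L ^+ k) by ring.
  by apply: ler_pM => //; exact: cabs_coef.
- by rewrite vE; apply: is_cvg_seriesZ; exact: is_cvg_series_exp_coeff.
split.
  by rewrite /mx_1F2 (mx_cvg_lim hG).
move=> k; apply: le_trans (bG k) _.
by rewrite vE lim_seriesZ//; exact: is_cvg_series_exp_coeff.
Qed.

Lemma mx_measurable_sum (I : Type) (r : seq I) (F : I -> R -> M) :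
  (forall i, mx_measurable (F i)) -> mx_measurable (fun s => \sum_(i <- r) F i s).
Proof.
move=> h; elim: r => [|i r IH].
  by under eq_fun do rewrite big_nil; exact: mx_measurable_cst.
by under eq_fun do rewrite big_cons; exact: mx_measurableD.
Qed.

(** Affine reduction to the unit interval, where the powers of the length [x - t]
    factor out. *)
Lemma kernel_moment P Q t x (k : nat) : GRing.comm P Q -> decays P -> decays Q -> t < x ->
  mx_integrable `]t, x[ (fun s => mxpow (P - 1) (x - s) * mxpow (Q + (k%:R)%:M - 1) (s - t)) /\
  mx_integral `]t, x[ (fun s => mxpow (P - 1) (x - s) * mxpow (Q + (k%:R)%:M - 1) (s - t)) =
    ((x - t) ^+ k)%:C *: (mxpow (P + Q - 1) (x - t) * Beta P (Q + (k%:R)%:M)).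
Proof.
move=> cPQ dP dQ tx; set l := x - t; have l0 : 0 < l by rewrite subr_gt0.
set Qk := Q + (k%:R)%:M; have dQk : decays Qk by exact: decays_addn.
set F := fun s => _.
have mF : mx_measurable F.
  by apply: mx_measurableM; apply: mx_measurable_mxpow; exact: measurable_funB.
have e01 : (fun u : R => t + l * u) @^-1` [set` `]t, x[] = [set` `]0, 1[].
  by apply/seteqP; split => u;
    rewrite /= !in_itv /= ltrDl pmulr_rgt0// -ltrBrDl -/l -{2}(mulr1 l) ltr_pM2l.
have FE u : `]0, 1[%classic u -> F (t + l * u) =
    (mxpow (P - 1) l * mxpow (Qk - 1) l) * beta_kernel P Qk u * 1.
  rewrite /= in_itv /= => /andP[u0 u1]; rewrite /F mulr1 /beta_kernel.
  have -> : x - (t + l * u) = l * (1 - u) by rewrite /l; ring.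
  have -> : t + l * u - t = l * u by ring.
  rewrite !mxpowM ?subr_gt0// !mulrA; congr (_ * _); rewrite -!mulrA; congr (_ * _).
  apply: mxpow_comm; apply: commr_sym; apply: mxpow_comm.
  apply: commrB; last exact: commr1.
  apply: commr_sym; apply: commrB; last exact: commr1.
  exact: comm_addn.
have m01 := measurable_itv (`]0, 1[ : interval R).
have [i1 e1] := mx_integral_lin (mxpow (P - 1) l * mxpow (Qk - 1) l) 1 m01
  (beta_kernel_integrable dP dQk).
have i2 : mx_integrable ((fun u : R => t + l * u) @^-1` [set` `]t, x[])
    (fun u => F (t + l * u)).
  by rewrite e01; apply: mx_integrable_eq i1 => // u /FE ->.
have [i3 ->] := mx_integral_affine l0 (measurable_itv _) mF i2.
split => //; rewrite e01 (mx_integral_eq FE) e1 mulr1 -BetaE.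
have -> : mxpow (Qk - 1) l = (l ^+ k)%:C *: mxpow (Q - 1) l.
  by rewrite /Qk addrAC mxpow_addn.
rewrite -scalerAr -!scalerAl !scalerA mulrC -scalerA; congr (_ *: _).
rewrite scalerAl; congr (_ * _).
have -> : P + Q - 1 = P - 1 + (Q - 1) + 1 by rewrite addrA subrK addrAC.
have cc : GRing.comm (P - 1) (Q - 1).
  apply: commrB; last exact: commr1.
  apply: commr_sym; apply: commrB; last exact: commr1.
  exact: commr_sym.
by rewrite mxpow_add1// (mxpow_add _ cc).
Qed.

(** The [2F3] series enters only as a limit [G]: its partial sums are [W ^ -1] times
    integrals that converge, where [W = (x - t) ^ (P + Q - 1) B(P, Q)] is invertible. *)
Lemma mx_1F2_integral A B E P Q z t x (G : M) : t < x ->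
  GRing.comm A B -> GRing.comm A E -> GRing.comm B E -> GRing.comm P Q ->
  decays B -> decays E -> decays P -> decays Q ->
  limn (series (fun k => ((z * (x - t)%:C) ^+ k / k`!%:R) *:
    (mx_poch Q k * (mx_poch (P + Q) k)^-1 * coef_1F2 A B E k))) = G ->
  has_mx_integral `]t, x[
    (fun s => mxpow (P - 1) (x - s) * mxpow (Q - 1) (s - t) * mx_1F2 A B E (z * (s - t)%:C))
    (mx_Gamma P * mx_Gamma Q * (mx_Gamma (P + Q))^-1 * mxpow (P + Q - 1) (x - t) * G).
Proof.
move=> tx cAB cAE cBE cPQ dB dE dP dQ hG.
set l := x - t; have l0 : 0 < l by rewrite subr_gt0.
have dPQ := decaysD cPQ dP dQ.
pose D : set R := [set` `]t, x[].
have mD : measurable D by exact: measurable_itv.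
have [L L0 hL] := mx_1F2_cvg cAB cAE cBE dB dE.
pose ker s := mxpow (P - 1) (x - s) * mxpow (Q - 1) (s - t).
pose T1 w k : M := (w ^+ k / k`!%:R) *: coef_1F2 A B E k.
pose T2 k : M := ((z * l%:C) ^+ k / k`!%:R) *:
    (mx_poch Q k * (mx_poch (P + Q) k)^-1 * coef_1F2 A B E k).
pose term k s : M := 1 * (mxpow (P - 1) (x - s) * mxpow (Q + (k%:R)%:M - 1) (s - t)) * T1 z k.
pose F_ m s := \sum_(0 <= k < m) term k s.
pose W := mxpow (P + Q - 1) l * Beta P Q.
have mom k := kernel_moment k cPQ dP dQ tx.
have termD k s : D s -> term k s = ker s * T1 (z * (s - t)%:C) k.
  rewrite /D /= in_itv /= => /andP[ts _]; have s0 : 0 < s - t by rewrite subr_gt0.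
  have eQ : mxpow (Q + (k%:R)%:M - 1) (s - t) = ((s - t) ^+ k)%:C *: mxpow (Q - 1) (s - t).
    by rewrite addrAC mxpow_addn.
  by rewrite /term eQ; apply: term_alg; rewrite exprMn rmorphXn /=; ring.
have F_D m s : D s -> F_ m s = ker s * series (T1 (z * (s - t)%:C)) m.
  move=> Ds; rewrite /F_ /series /= mulr_sumr; apply: eq_bigr => k _.
  exact: termD.
have iker : mx_integrable D ker.
  apply: mx_integrable_eq (mom 0%N).1 => // s _.
  by rewrite raddf0 addr0.
have eF m : mx_integral D (F_ m) = W * series T2 m.
  have it k := mx_integral_lin 1 (T1 z k) mD (mom k).1.
  have [_ ->] := mx_integral_sum (index_iota 0 m) mD (fun k => (it k).1).
  rewrite /series /= mulr_sumr; apply: eq_bigr => k _.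
  rewrite (it k).2 mul1r (mom k).2 -/l /T1 /T2 /W.
  have -> : Beta P (Q + (k%:R)%:M) = Beta P Q * (mx_poch Q k * (mx_poch (P + Q) k)^-1).
    by rewrite mulrA -Beta_pochr// mulrK// poch_unit.
  rewrite -!scalerAr -scalerAl !scalerA !mulrA; congr (_ *: _).
  by rewrite exprMn rmorphXn; ring.
have [iF hF] : mx_integrable D (fun s => ker s * mx_1F2 A B E (z * (s - t)%:C)) /\
    mx_cvg \oo (fun m => mx_integral D (F_ m))
      (mx_integral D (fun s => ker s * mx_1F2 A B E (z * (s - t)%:C))).
  apply: (mx_dct (g := fun s => (nrm (1 : M) * expR (cabs z * l * L)) * nrm (ker s)) mD).
  - move=> m; apply: mx_measurable_sum => k; apply: mx_measurableM; last exact: mx_measurable_cst.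
    apply: mx_measurableM; first exact: mx_measurable_cst.
    by apply: mx_measurableM; apply: mx_measurable_mxpow; exact: measurable_funB.
  - move=> s Ds.
    apply: (@mx_cvg_near _ _ (fun m => ker s * series (T1 (z * (s - t)%:C)) m)).
      by apply: nearW => m; rewrite F_D.
    by apply: mx_cvgM; [exact: mx_cvg_cst|exact: (hL _).1].
  - move=> m s Ds; rewrite F_D// [leRHS]mulrC; apply: le_trans (nrmM _ _) _.
    apply: ler_pM => //; apply: le_trans ((hL _).2 m) _.
    rewrite ler_wpM2l// ler_expR ler_wpM2r//; apply: le_trans (cabsM _ _) _.
    rewrite ler_wpM2l//; move: Ds; rewrite /D /= in_itv /= => /andP[ts sx].
    by rewrite /cabs /= normr0 addr0 ger0_norm ?subr_ge0 ?(ltW ts)// /l lerB// ltW.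
  - have [h _] := Rintegrable_lin [:: tt] (fun=> nrm (1 : M) * expR (cabs z * l * L)) mD
      (fun=> Rintegrable_nrm mD iker).
    by apply: eq_integrable h => // v _; congr EFin; rewrite big_cons big_nil addr0.
split => //.
set V := mx_integral _ _ in hF *.
have eB : Beta P Q = mx_Gamma P * mx_Gamma Q * (mx_Gamma (P + Q))^-1.
  have cG : mx_Gamma P * mx_Gamma Q = mx_Gamma Q * mx_Gamma P.
    by apply: comm_Gamma => //; apply: commr_sym; apply: comm_Gamma => //; exact: commr_sym.
  exact: div_alg (etrans cG (Gamma_Beta cPQ dP dQ)) (Gamma_unit dPQ).
have uB : Beta P Q \is a GRing.unit.
  by rewrite eB; exact: unit_alg (Gamma_unit dP) (Gamma_unit dQ) (Gamma_unit dPQ).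
have cW : W = Beta P Q * mxpow (P + Q - 1) l.
  apply/commr_sym/mxpow_comm/commr_sym; apply: comm_Beta => //; apply: commr_sym.
    by apply: commrB; [exact: commrD|exact: commr1].
  apply: commrB; last exact: commr1.
  by apply: commrD => //; exact: commr_sym.
have uW : W \is a GRing.unit by rewrite cW unitrMr//; exact: mexp_unit.
have hT2 : mx_cvg \oo (series T2) (W^-1 * V).
  have := mx_cvgM (mx_cvg_cst W^-1) hF => /(_ _) h.
  by apply: mx_cvg_near (h _); apply: nearW => m; rewrite eF mulKr.
have <- : W^-1 * V = G by rewrite -hG (mx_cvg_lim hT2).
exact: solve_alg cW eB uW.
Qed.

End Hypergeometric.

Lemma coef23_alg (T : pzRingType) (a q b r e : T) :
  GRing.comm a q -> GRing.comm a r -> GRing.comm b r ->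
  q * r * (a * b * e) = a * q * b * r * e.
Proof.
move=> aq ar br; rewrite aq !mulrA; congr (_ * _).
by rewrite -(mulrA q r) -ar -!mulrA -br.
Qed.

Theorem theorem2p6 (R : realType) (N : nat) (hN : (0 < N)%N)
    (A B C P Q : 'M[R[i]]_N)
    (hcomm : all2rel comm_mxb [:: A; B; C; P; Q])
    (hA : positive_stable A) (hB : positive_stable B) (hC : positive_stable C)
    (hP : positive_stable P) (hQ : positive_stable Q) :
  [/\ forall (z : R[i]) (t x : R), `|z| < 1 -> t < x ->
        has_mx_integral `]t, x[
          (fun s => mx_rpow (x - s) (P - 1%:M) *m mx_rpow (s - t) (Q - 1%:M) *m
                    mx_1F2 A B C (z * (s - t)%:C))
          (mx_Gamma P *m mx_Gamma Q *m invmx (mx_Gamma (P + Q)) *m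
           mx_rpow (x - t) (P + Q - 1%:M) *m
           mx_2F3 A Q B (P + Q) C (z * (x - t)%:C)),
      forall x y : R, x < y ->
        has_mx_integral `]x, y[
          (fun t => mx_rpow (y - t) (P - 1%:M) *m mx_rpow (t - x) (Q - 1%:M) *m
                    mx_1F2 A B C (t - x)%:C)
          (mx_Gamma P *m mx_Gamma Q *m invmx (mx_Gamma (P + Q)) *m
           mx_rpow (y - x) (P + Q - 1%:M) *m
           mx_2F3 A Q (P + Q) B C (y - x)%:C)
    & forall x y : R, x < y ->
        has_mx_integral `]x, y[
          (fun t => mx_rpow (y - t) (P - 1%:M) *m mx_rpow (t - x) (Q - 1%:M) *m
                    mx_1F2 A B C (x - t)%:C)
          (mx_Gamma P *m mx_Gamma Q *m invmx (mx_Gamma (P + Q)) *m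
           mx_rpow (y - x) (P + Q - 1%:M) *m
           mx_2F3 A Q (P + Q) B C (x - y)%:C)].
Proof.
case: N hN A B C P Q hcomm hA hB hC hP hQ => // n _ A B C P Q hcomm _ hB hC hP hQ.
have hc X Y : X \in [:: A; B; C; P; Q] -> Y \in [:: A; B; C; P; Q] -> GRing.comm X Y.
  by move=> hX hY; move/allrelP : hcomm => /(_ X Y hX hY) /eqP.
have [dB dC] := (positive_stable_decay hB, positive_stable_decay hC).
have [dP dQ] := (positive_stable_decay hP, positive_stable_decay hQ).
have hAB : GRing.comm A B by apply: hc; rewrite !inE eqxx ?orbT.
have hAC : GRing.comm A C by apply: hc; rewrite !inE eqxx ?orbT.
have hAP : GRing.comm A P by apply: hc; rewrite !inE eqxx ?orbT.
have hAQ : GRing.comm A Q by apply: hc; rewrite !inE eqxx ?orbT.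
have hBC : GRing.comm B C by apply: hc; rewrite !inE eqxx ?orbT.
have hBP : GRing.comm B P by apply: hc; rewrite !inE eqxx ?orbT.
have hBQ : GRing.comm B Q by apply: hc; rewrite !inE eqxx ?orbT.
have hPQ : GRing.comm P Q by apply: hc; rewrite !inE eqxx ?orbT.
have comm_pp (X Y : 'M[R[i]]_n.+1) k : GRing.comm X Y -> GRing.comm (mx_poch X k) (mx_poch Y k).
  by move=> h; apply: comm_poch; apply: commr_sym; apply: comm_poch; exact: commr_sym.
have cAQ k := comm_pp A Q k hAQ.
have cAr k : GRing.comm (mx_poch A k) (mx_poch (P + Q) k)^-1.
  by apply: commrV; apply: comm_pp; exact: commrD.
have cBr k : GRing.comm (mx_poch B k)^-1 (mx_poch (P + Q) k)^-1.
  apply: commrV; apply: commr_sym; apply: commrV; apply: commr_sym.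
  by apply: comm_pp; exact: commrD.
have main z t x (G : 'M[R[i]]_n.+1) (tx : t < x) :=
  @mx_1F2_integral R n A B C P Q z t x G tx hAB hAC hBC hPQ dB dC dP dQ.
have eF (X : 'M[R[i]]_n.+1) s : mx_rpow s (X - 1%:M) = mxpow (X - 1) s by exact: mxpow_rpow.
have coefE k : mx_poch Q k * (mx_poch (P + Q) k)^-1 * coef_1F2 A B C k =
    mx_poch A k *m mx_poch Q k *m invmx (mx_poch B k) *m
    invmx (mx_poch (P + Q) k) *m invmx (mx_poch C k).
  exact: coef23_alg.
have coefE' k : mx_poch Q k * (mx_poch (P + Q) k)^-1 * coef_1F2 A B C k =
    mx_poch A k *m mx_poch Q k *m invmx (mx_poch (P + Q) k) *m
    invmx (mx_poch B k) *m invmx (mx_poch C k).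
  rewrite coefE; congr (_ *m _); rewrite -!mulmxA; congr (_ *m (_ *m _)).
  exact: cBr.
have eN (a b : R) : -1 * (a - b)%:C = (b - a)%:C :> R[i].
  by rewrite mulN1r -(opprB a b) rmorphN.
split=> [z t x _ tx|x y xy|x y xy].
- have -> : (fun s => mx_rpow (x - s) (P - 1%:M) *m mx_rpow (s - t) (Q - 1%:M) *m
      mx_1F2 A B C (z * (s - t)%:C)) =
      (fun s => mxpow (P - 1) (x - s) * mxpow (Q - 1) (s - t) * mx_1F2 A B C (z * (s - t)%:C)).
    by apply/funext => s; rewrite !eF.
  rewrite eF; apply: (main z t x _ tx).
  by rewrite /mx_2F3; under eq_fun do rewrite coefE.
- have -> : (fun t => mx_rpow (y - t) (P - 1%:M) *m mx_rpow (t - x) (Q - 1%:M) *m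
      mx_1F2 A B C (t - x)%:C) =
      (fun s => mxpow (P - 1) (y - s) * mxpow (Q - 1) (s - x) * mx_1F2 A B C (1 * (s - x)%:C)).
    by apply/funext => s; rewrite !eF mul1r.
  rewrite eF; apply: (main 1 x y _ xy).
  by rewrite /mx_2F3 mul1r; under eq_fun do rewrite coefE'.
- have -> : (fun t => mx_rpow (y - t) (P - 1%:M) *m mx_rpow (t - x) (Q - 1%:M) *m
      mx_1F2 A B C (x - t)%:C) =
      (fun s => mxpow (P - 1) (y - s) * mxpow (Q - 1) (s - x) * mx_1F2 A B C (-1 * (s - x)%:C)).
    by apply/funext => s; rewrite !eF eN.
  rewrite eF; apply: (main (-1) x y _ xy).
  by rewrite /mx_2F3 eN; under eq_fun do rewrite coefE'.
Qed.
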